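(* Let $G$ be a connected chordal graph. Let $\mathcal{F}_3^{\mathrm{ch}}=\{K_4,\ \text{kite},\ \text{gem},\ X_{127}\}\cup\{D_k : k\in\mathbb{Z},\ k\ge 4\}$. The following statements are equivalent. 1. $G$ is $\mathcal{F}_3^{\mathrm{ch}}$-free, that is, no induced subgraph of $G$ is isomorphic to a member of $\mathcal{F}_3^{\mathrm{ch}}$. 2. If $G$ is not a trivial (one-vertex) graph, then (a) each block of $G$ is a crown; (b) any two blocks that are nontrivial crowns either share a vertex or are at distance at least $2$; (c) except in the case of a triangle sharing vertices only with trivial blocks, two blocks can only share a vertex in their bases; and (d) the path joining two nontrivial blocks at positive distance contains at least one vertex of degree $2$ in $G$. 3. $\chi_\star(G)\le 3$.
   Context: Graphs are finite, with no loops or parallel edges. A star coloring of $G$ is a proper vertex coloring in which no path on four vertices (as a not necessarily induced subgraph) uses only two colors; $\chi_\star(G)$ is the minimum number of colors in a star coloring of $G$. A graph is chordal if it has no induced cycle of length at least four. For an integer $n\ge 0$ the $n$-crown is the join $nK_1\oplus K_2$ (two adjacent vertices together with $n$ pairwise non-adjacent vertices, each adjacent to both of them); a crown is an $n$-crown for some $n\ge 0$. The $0$-crown $K_2$ is the trivial crown; the $1$-crown is $K_3$; the $2$-crown is the diamond. The base of a crown is the $K_2$ in the definition; for $K_3$ any edge can play this role, and exactly one of its edges is fixed (chosen) as the base. A block that is a trivial crown is a trivial block; other blocks are nontrivial. In (c), the condition means that the bases of the triangle blocks can be chosen so that every vertex shared by two blocks lies in the bases of both, where triangle blocks that meet only trivial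 blocks are exempt from the restriction. The distance between two blocks is the minimum distance between a vertex of one and a vertex of the other, and the path joining them is a shortest path between them. Forbidden graphs: the kite is the diamond plus one pendant vertex attached to a vertex of degree $2$ of the diamond. The gem is a path on four vertices plus a vertex adjacent to all of it. $X_{127}$ is the $7$-vertex graph obtained from two triangles $\{v,a,b\}$ and $\{v,c,d\}$ sharing exactly the vertex $v$ by adding one pendant vertex adjacent to $a$ and another one adjacent to $b$. For $k\ge 4$, the $k$-centipede has vertices $u_1,\dots,u_k,v_1,\dots,v_k$ and edges $u_iv_i$ ($1\le i\le k$) and $u_iu_{i+1}$ ($1\le i\le k-1$); $D_k$ is obtained from it by identifying $v_1$ with $v_2$ and identifying $v_{k-1}$ with $v_k$ (so $D_4$ is two disjoint triangles joined by an edge). *)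

(* Defs.v *)
From mathcomp Require Import all_boot.

Set Implicit Arguments.
Unset Strict Implicit.
Unset Printing Implicit Defensive.

Record sgraph := SGraph {
  svertex :> finType;
  sedge : rel svertex;
  sedge_sym : symmetric sedge;
  sedge_irrefl : irreflexive sedge }.

Notation "x -- y" := (sedge x y) (at level 30).

Section GraphOfRel.
Variables (T : finType) (r : rel T).

Definition symirr_rel : rel T := fun x y => (x != y) && (r x y || r y x).

Lemma symirr_rel_sym : symmetric symirr_rel.
Proof. by move=> x y; rewrite /symirr_rel eq_sym orbC. Qed.

Lemma symirr_rel_irrefl : irreflexive symirr_rel.
Proof. by move=> x; rewrite /symirr_rel eqxx. Qed.

Definition graph_of_rel : sgraph := SGraph symirr_rel_sym symirr_rel_irrefl.

End GraphOfRel.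

Definition graph_of_edges (n : nat) (s : seq (nat * nat)) : sgraph :=
  graph_of_rel [rel i j : 'I_n | (val i, val j) \in s].

(** "Some induced subgraph of [G] is isomorphic to [H]". *)
Definition induced_copy (H G : sgraph) : Prop :=
  exists2 f : H -> G, injective f & forall x y : H, (f x -- f y) = (x -- y).

Definition free_of (F : sgraph -> Prop) (G : sgraph) : Prop :=
  forall H : sgraph, F H -> ~ induced_copy H G.

Definition cycle_graph (n : nat) : sgraph :=
  graph_of_rel [rel i j : 'I_n | j == ordS i].

Definition chordal (G : sgraph) : Prop :=
  forall n : nat, 4 <= n -> ~ induced_copy (cycle_graph n) G.

Definition K4 : sgraph := graph_of_rel [rel i j : 'I_4 | i != j].

(** The diamond has base [{1, 2}] and degree-2 vertices [0] and [3]; the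
    pendant vertex is [4]. *)
Definition kite : sgraph :=
  graph_of_edges 5 [:: (1, 2); (0, 1); (0, 2); (3, 1); (3, 2); (3, 4)].

Definition gem : sgraph :=
  graph_of_edges 5 [:: (0, 1); (1, 2); (2, 3); (4, 0); (4, 1); (4, 2); (4, 3)].

(** [v, a, b, c, d] are [0, 1, 2, 3, 4]; the pendant vertices are [5] and
    [6]. *)
Definition X127 : sgraph :=
  graph_of_edges 7 [:: (0, 1); (0, 2); (1, 2); (0, 3); (0, 4); (3, 4);
                       (1, 5); (2, 6)].

(** The [k]-centipede with [v_1, v_2] identified and [v_(k-1), v_k]
    identified. With 0-based indices, [inl i] is [u_i] and [inr j] is the [j]th
    of the [k - 2] classes of the vertices [v_0, ..., v_(k-1)]: for [4 <= k],
    the class of [v_i] is [minn i.-1 (k - 3)]. *)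
Definition D_rel (k : nat) : rel ('I_k + 'I_(k - 2)) := fun x y =>
  match x, y with
  | inl i, inl j => i.+1 == j
  | inl i, inr j => minn i.-1 (k - 3) == j
  | _, _ => false
  end.

Definition D (k : nat) : sgraph := graph_of_rel (@D_rel k).

Inductive F3ch : sgraph -> Prop :=
| F3ch_K4 : F3ch K4
| F3ch_kite : F3ch kite
| F3ch_gem : F3ch gem
| F3ch_X127 : F3ch X127
| F3ch_D (k : nat) : 4 <= k -> F3ch (D k).

Section Graph.
Variable G : sgraph.
Implicit Types (x y z w : G) (A B S : {set G}).

Definition degree x : nat := #|[set y | x -- y]|.

Definition connected_graph : Prop := forall x y, connect (@sedge G) x y.

(** Connectedness of the subgraph induced by [A]. *)
Definition connected_in A : bool :=
  [forall x in A, forall y in A, connect [rel u v in A | u -- v] x y].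

(** A block is a maximal connected subgraph without a cut vertex; such a
    subgraph is induced, so it is represented by its vertex set. *)
Definition block B : bool :=
  maxset (fun A : {set G} =>
    [&& A != set0, connected_in A & [forall v in A, connected_in (A :\ v)]]) B.

(** [B] induces the join of [n K_1] (on [B :\: S]) and [K_2] (on [S]). *)
Definition crown_with_base (n : nat) B S : bool :=
  [&& S \subset B, #|S| == 2, #|B :\: S| == n,
      [forall x in S, forall y in B, (x != y) ==> (x -- y)]
    & [forall x in B :\: S, forall y in B :\: S, ~~ (x -- y)]].

Definition ncrown (n : nat) B : bool :=
  [exists S : {set G}, crown_with_base n B S].

Definition crown B : Prop := exists n : nat, ncrown n B.

Definition trivial_block B : bool := block B && ncrown 0 B.

Definition nontrivial_block B : bool := block B && ~~ ncrown 0 B.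

Definition exempt_triangle B : Prop :=
  ncrown 1 B /\
  forall B', block B' -> B' != B -> B :&: B' != set0 -> trivial_block B'.

(** The bound [#|G|] stands for an infinite distance; it is never the distance
    of two vertices in a connected graph. *)
Definition dist x y : nat :=
  \big[minn/#|G|]_(n < #|G| |
     [exists p : n.-tuple G, path (@sedge G) x p && (last x p == y)]) n.

Definition set_dist A B : nat :=
  \big[minn/#|G|]_(x in A) \big[minn/#|G|]_(y in B) dist x y.

(** The base of a crown is determined except for [K_3], where the choice
    function [base] selects one edge. *)
Definition share_only_in_bases : Prop :=
  exists base : {set G} -> {set G},
    (forall B, block B -> exists n : nat, crown_with_base n B (base B)) /\
    (forall B B' x, block B -> block B' -> B != B' -> x \in B -> x \in B' ->
       ~ exempt_triangle B -> x \in base B).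

(** The path [x :: p] is a shortest one between [B] and [B']. *)
Definition joining_path B B' x (p : seq G) : Prop :=
  [/\ x \in B, last x p \in B', path (@sedge G) x p
    & size p = set_dist B B'].

Definition crown_structure : Prop :=
  [/\ forall B, block B -> crown B,
      forall B B', nontrivial_block B -> nontrivial_block B' ->
        B :&: B' != set0 \/ 2 <= set_dist B B',
      share_only_in_bases
    & forall B B', nontrivial_block B -> nontrivial_block B' ->
        0 < set_dist B B' ->
        forall x p, joining_path B B' x p ->
        exists2 z, z \in x :: p & degree z = 2].

Definition star_coloring (C : finType) (c : {ffun G -> C}) : bool :=
  [forall x, forall y, (x -- y) ==> (c x != c y)] &&
  [forall x, forall y, forall z, forall w,
     [&& uniq [:: x; y; z; w], x -- y, y -- z & z -- w] ==>
     (2 < #|[set c x; c y; c z; c w]|)].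

Definition star_colorable (k : nat) : bool :=
  [exists c : {ffun G -> 'I_k}, star_coloring c].

Lemma star_colorable_ex : exists k, star_colorable k.
Proof.
exists #|G|; apply/existsP; exists [ffun x => enum_rank x]; apply/andP; split.
  apply/forallP=> x; apply/forallP=> y; apply/implyP=> exy; rewrite !ffunE.
  by apply: contraTneq exy => /enum_rank_inj ->; rewrite sedge_irrefl.
apply/forallP=> x; apply/forallP=> y; apply/forallP=> z; apply/forallP=> w.
apply/implyP=> /and4P[+ _ _ _].
rewrite -(map_inj_uniq enum_rank_inj) => /card_uniqP/= U; rewrite !ffunE.
rewrite (_ : 2 < _ = (2 < 4)) // -[in RHS]U; congr (_ < _).
by apply: eq_card => i; rewrite !inE !orbA.
Qed.

Definition chi_star : nat := ex_minn star_colorable_ex.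

End Graph.

(* Main.v *)
Require Import Defs.
From mathcomp Require Import all_boot.
From mathcomp Require Import fingroup perm zify.

Set Implicit Arguments.
Unset Strict Implicit.
Unset Printing Implicit Defensive.

(** In a star colouring two colour classes span a forest of stars, so every
    edge has an end that is a leaf of its two-coloured star. With three colours
    the corner [v] of a triangle already sees both other colours in the
    triangle, hence any further neighbour of [v] is a leaf at [v]
    ([leaf_triangle]). If [w] is such a leaf and has two further neighbours,
    these get the same colour and are in turn leaves at [w] ([leaf_step]).
    So a triangle pushes a constraint outwards along every path, and only a
    vertex of degree 2 stops it; two triangles joined by a path without such a
    vertex contradict each other. This excludes the graphs [D k]; similar
    arguments exclude [X127], the kite and the gem, and [K4] needs four colours
    ([free_of_star_colorable]).

    Conversely, let [G] be connected, chordal and free of the forbidden graphs.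
    Three local facts carry everything else: an apex of a diamond has degree 2
    ([diamond_adj]), of two triangles sharing exactly one vertex each has a
    further corner of degree 2 ([two_triangles_degree2]), and a shortest path
    between two disjoint triangles has an interior vertex of degree 2
    ([linked_degree2]). A vertex of degree 2 with non-adjacent neighbours is a
    cut vertex, because a detour around it would close an induced cycle
    ([chordal_detour]); 3-colourings of the two sides, both taken with the cut
    vertex, can be glued after a permutation of the colours ([star_glue]). When
    no such vertex is left, any two triangles meet, so that either there is at
    most one triangle or all triangles share a hub and each has a corner of
    degree 2 ([windmill_hub]). In both cases deleting one edge of each triangle
    leaves a tree, and depth modulo 3 in that tree is a star colouring
    ([depth_star], [star_windmill], [star_unicyclic]).

    The block description rests on the same three facts. A block is a crown
    whose base is an edge with the most common neighbours ([block_crown]); the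
    fact on diamonds confines sharing to the base of a crown with two or more
    apexes, the fact on pairs of triangles does so for triangle blocks, and the
    fact on shortest paths gives both conditions on distances. Backwards, every
    triangle of a crown contains its base ([base_in_triangle]), which places
    each of [K4], the kite, the gem and [X127] in conflict with the conditions,
    and a path that leaves a block through a vertex cannot come back without
    that vertex ([block_gate]), so that the two end triangles of a [D k] lie in
    disjoint blocks all of whose shortest joining paths avoid degree 2
    ([no_linked_blocks]). *)

(** * Shortest paths *)
Section ShortestPath.
Variables (T : finType) (e : rel T).
Implicit Types (x y : T) (p q : seq T).

Definition shortest x y p : Prop :=
  [/\ path e x p, last x p = y
    & forall q, path e x q -> last x q = y -> size p <= size q].

Lemma shortest_exists x y : connect e x y -> exists p, shortest x y p.
Proof.
case/connectP=> p0 p0P p0y.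
pose Q n := [exists p : n.-tuple T, path e x p && (last x p == y)].
have exQ : exists n, Q n.
  exists (size p0); apply/existsP; exists (in_tuple p0).
  by rewrite p0P -p0y eqxx.
case: (ex_minnP exQ) => n /existsP[p /andP[pP /eqP py]] nmin.
exists p; split=> // q qP qy; rewrite size_tuple; apply: nmin.
by apply/existsP; exists (in_tuple q); rewrite qP qy eqxx.
Qed.

Lemma shortest_uniq x y p : shortest x y p -> uniq (x :: p).
Proof.
case=> pP py pmin; case: (shortenP pP) (py) => q qP qU qp qy.
apply: (leq_size_uniq qU); last by rewrite /= ltnS pmin.
by move=> z; rewrite !inE => /orP[->|/qp ->]; rewrite ?orbT.
Qed.

Lemma nth_cons_last_take z x p i : i <= size p ->
  nth z (x :: p) i = last x (take i p).
Proof.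
elim: p x i => [|y p IH] x [|i] //= ip; exact: (IH y i).
Qed.

(** A chord between the [i]-th and [j]-th vertices would allow the part between
    them to be cut out. *)
Lemma shortest_chordless x y p i j : shortest x y p -> i < j <= size p ->
  e (nth x (x :: p) i) (nth x (x :: p) j) -> j = i.+1.
Proof.
case=> pP py pmin /andP[ij jp] eij.
have jE : nth x (x :: p) j = nth x p j.-1 by case: j ij {jp eij}.
have iE := nth_cons_last_take x x (leq_trans (ltnW ij) jp).
have lE := nth_cons_last_take x x jp.
have dE : drop j.-1 p = nth x p j.-1 :: drop j p.
  by rewrite (drop_nth x) ?prednK //; lia.
have := pP; rewrite -[p in path e x p](cat_take_drop i) cat_path => /andP[p1 _].
have := pP; rewrite -[p in path e x p](cat_take_drop j) cat_path -lE => /andP[_ p2].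
have py' : last (nth x (x :: p) j) (drop j p) = y.
  by rewrite lE -last_cat cat_take_drop.
have := pmin (take i p ++ drop j.-1 p).
rewrite cat_path last_cat dE /= -iE -jE eij p1 p2 py' => /(_ isT erefl).
rewrite size_cat /= size_takel ?size_drop; lia.
Qed.

End ShortestPath.

(** * Chordal graphs: detours and common neighbours *)
Section ChordalTools.
Variable G : sgraph.
Implicit Types (x y z w : G) (A B K : {set G}) (s p : seq G).

Lemma adj_neq x y : x -- y -> x != y.
Proof. by apply: contraTneq => ->; rewrite sedge_irrefl. Qed.

Lemma cycle_graph_adj N (i j : 'I_N.+1) : 1 < N -> i < j ->
  @sedge (cycle_graph N.+1) i j = (j == i.+1 :> nat) || (i == 0 :> nat) && (j == N :> nat).
Proof.
move=> N1 ij; rewrite /= /symirr_rel /= -!val_eqE /=.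
have jN := ltn_ord j.
rewrite [i.+1 %% _]modn_small; last lia.
have [jE|jlt] := eqVneq (nat_of_ord j) N; last by rewrite modn_small; lia.
by rewrite jE modnn; lia.
Qed.

Lemma induced_cycle w s : 2 < size s -> uniq (w :: s) ->
  (forall i j, i < j < size s -> (nth w s i -- nth w s j) = (j == i.+1)) ->
  (forall i, i < size s -> (w -- nth w s i) = (i == 0) || (i.+1 == size s)) ->
  induced_copy (cycle_graph (size s).+1) G.
Proof.
move=> s2 sU sE wE.
pose f (i : cycle_graph (size s).+1) := nth w (w :: s) (val i).
exists f => [i j /eqP|].
  by rewrite nth_uniq ?ltn_ord // => /eqP /val_inj.
have main (i j : 'I_(size s).+1) : i < j ->
  (f i -- f j) = @sedge (cycle_graph (size s).+1) i j.
  move=> ij; rewrite cycle_graph_adj // ?(ltnW s2) //.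
  have := ltn_ord j; rewrite /f /=.
  case: (nat_of_ord j) (nat_of_ord i) ij => [|b] [|a] //= ab bs.
    rewrite wE //; lia.
  rewrite sE; lia.
move=> i j; case: (ltngtP i j) => [|ji|/val_inj ->]; first exact: main.
  by rewrite sedge_sym main // sedge_sym.
by rewrite !sedge_irrefl.
Qed.

Hypothesis chG : chordal G.

(** The relation is [connect] in the induced subgraph, but it also holds between
    a vertex outside [A] and itself. *)
Definition con A : rel G := connect [rel u v in A | u -- v].

Lemma con_sym A : symmetric (con A).
Proof.
apply: sym_connect_sym => x y /=.
by rewrite sedge_sym andbC [(x \in A) && _]andbC andbC.
Qed.

Lemma con_trans A : transitive (con A).
Proof. exact: connect_trans. Qed.

Lemma con0 A x : con A x x.
Proof. exact: connect0. Qed.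

Lemma con1 A x y : x \in A -> y \in A -> x -- y -> con A x y.
Proof. by move=> xA yA xy; apply: connect1; rewrite /= xA yA. Qed.

Lemma con_sub A B x y : A \subset B -> con A x y -> con B x y.
Proof.
move=> /subsetP AB; apply: connect_sub => u v /= /andP[/andP[uA vA] uv].
by apply: con1; rewrite ?AB.
Qed.

Lemma path_inP A x p : x \in A ->
  path [rel u v in A | u -- v] x p = path (@sedge G) x p && all [in A] p.
Proof.
elim: p x => //= y p IH x xA; rewrite xA /=.
by case yA: (y \in A); rewrite ?andbF //= IH // andbA.
Qed.

Lemma path_con A x p : path (@sedge G) x p -> all [in A] (x :: p) ->
  con A x (last x p).
Proof.
move=> pP /= /andP[xA pA]; apply/connectP; exists p => //.
by rewrite path_inP // pP.
Qed.

Lemma con_in A x y : con A x y -> x != y -> (x \in A) && (y \in A).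
Proof.
case/connectP=> p pP -> xny.
have xA : x \in A by case: p pP xny => [|z p] /=; [rewrite eqxx | case: (x \in A)].
move: pP; rewrite path_inP // xA => /andP[_ /allP pA].
by case/lastP: p pA xny => [|p z pA _]; rewrite ?eqxx // last_rcons pA // mem_rcons mem_head.
Qed.

Lemma con_path A x y : x \in A -> con A x y -> exists p,
  [/\ shortest [rel u v in A | u -- v] x y p, path (@sedge G) x p,
      all [in A] (x :: p) & last x p = y].
Proof.
move=> xA /shortest_exists[p sp]; exists p; case: (sp) => pP py _.
by move: pP; rewrite path_inP // => /andP[] ? ?; rewrite /= xA.
Qed.

(** The main use of chordality: if [x] and [y] were not adjacent, a shortest
    path from [x] to [y] inside [A] would be induced and have an inner vertex;
    [w] sees only its two ends, so [w] would close it to an induced cycle of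
    length at least four. *)
Lemma chordal_detour A w x y :
  w -- x -> w -- y -> x != y -> w \notin A -> con A x y ->
  (forall z, z \in A -> w -- z -> z = x \/ z = y) -> x -- y.
Proof.
move=> wx wy xny wA xcy onlyxy.
have /andP[xA yA] := con_in xcy xny.
have [p [sp pP pA py]] := con_path xA xcy.
apply: contraT => nxy; exfalso.
have sU := shortest_uniq sp.
have p1 : 1 < size p.
  move: pP py xny nxy; case: p {sp pA sU} => [|a [|b p]] //=; first by move=> _ -> /eqP.
  by move=> /andP[xa _] <-; rewrite xa.
have inA i : i < size (x :: p) -> nth w (x :: p) i \in A.
  by move=> ip; apply: (allP pA); rewrite mem_nth.
have nthx i : i < size (x :: p) -> nth w (x :: p) i = nth x (x :: p) i.
  by move=> ip; apply: set_nth_default.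
have lasty : nth w (x :: p) (size p) = y.
  by rewrite -[size p]/(size (x :: p)).-1 nth_last.
apply: (chG _ (@induced_cycle w (x :: p) _ _ _ _)) => //.
- by rewrite cons_uniq sU andbT; apply: contra wA => /(allP pA).
- move=> i j /andP[ij js]; apply/idP/eqP => [eij|jE].
    apply: (shortest_chordless sp); first by rewrite ij -ltnS.
    by rewrite -!nthx ?(ltn_trans ij) //= !inA ?(ltn_trans ij).
  by rewrite jE; rewrite jE in js; move/(pathP w): pP; apply.
- move=> i ip; apply/idP/orP => [wi|[/eqP->//|]].
    have [wi'|wi'] := onlyxy _ (inA _ ip) wi.
      by left; rewrite -(nth_uniq w ip _ sU) // wi'.
    by right; rewrite eqSS -(nth_uniq w ip _ sU) // wi' lasty.
  by rewrite eqSS => /eqP ->; rewrite lasty.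
Qed.

(** Follow a path in [A] from a neighbour of [x] to a neighbour of [y], starting at
    the last neighbour of [x]. Then [x] sees only that vertex and [y] on the
    closed walk through [y], so [chordal_detour] makes the two adjacent. *)
Lemma chordal_common_nbr A x y k l : x -- y -> x \notin A -> y \notin A ->
  k \in A -> con A k l -> x -- k -> y -- l ->
  exists z, [/\ z \in A, con A k z, x -- z & y -- z].
Proof.
move=> xy xA yA kA kl xk yl.
have [p [_ pP pA pl]] := con_path kA kl.
have [n] := ubnP (size p); elim: n => // n IH in k p kA kl xk pP pA pl *.
rewrite ltnS => pn.
have [/hasP[z zp xz]|/hasPn nop] := boolP (has (sedge x) p).
  move: pP pA pl pn; case/splitPr: zp => p1 p2.
  rewrite cat_path /= all_cat last_cat /= => /and3P[pP1 lz pP2] /and4P[_ pA1 zA pA2] pl.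
  rewrite size_cat /= => pn.
  have kpA : all [in A] (k :: p1) by rewrite /= kA.
  have kz : con A k z.
    apply: con_trans (path_con pP1 kpA) (con1 _ zA lz).
    exact: (allP kpA) (mem_last _ _).
  have zl : con A z l by rewrite -pl; apply: path_con; rewrite /= ?zA.
  have p2n : size p2 < n := leq_trans (leq_addl _ _) pn.
  have [||t [tA zt xt yt]] := IH z p2 zA zl xz pP2 _ pl => //; first by rewrite /= zA.
  by exists t; split=> //; apply: con_trans kz zt.
(* No later vertex of the path is adjacent to [x], so among the path and [y]
   only [k] and [y] are, and the detour from [k] to [y] forces [k -- y]. *)
exists k; split=> //; rewrite ?con0 //.
apply: (@chordal_detour (y |: [set z in k :: p]) x) => //.
- by apply: contraNneq yA => ->.
- rewrite !inE !negb_or (adj_neq xy) (adj_neq xk) /=.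
  by apply: contra xA => xp; apply: (allP pA); rewrite /= inE xp orbT.
- rewrite con_sym; apply: con_trans (con1 _ _ _ : con _ l y).
  + rewrite -pl; apply: path_con => //; apply/allP => z zp.
    by rewrite !inE /= -in_cons zp orbT.
  + by rewrite -pl !inE -in_cons mem_last orbT.
  + by rewrite !inE eqxx.
  + by rewrite sedge_sym.
- move=> z; rewrite !inE => /or3P[/eqP->|/eqP->|zp] xz; [by left|by right|].
  by have := nop _ zp; rewrite xz.
Qed.

End ChordalTools.

(** * Excluding the four small graphs *)
Ltac adj := first [assumption | rewrite sedge_sym; assumption
  | rewrite eq_sym; assumption | apply: adj_neq; assumption
  | rewrite eq_sym; apply: adj_neq; assumption ].
Ltac conj_adj := rewrite /= ?inE ?negb_or; repeat (apply/andP; split); try done; adj.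

Section SmallCopies.
Variable G : sgraph.
Implicit Types (a b c d h l m s t v w x y z : G) (xs : seq G).

Definition nat_pairs n := [seq (i, j) | j <- iota 0 n, i <- iota 0 j].

(** [E] and [NE] list the pairs of indices that have to be adjacent and
    non-adjacent. That they cover all pairs is a closed computation, so only
    the listed facts about [G] remain to be supplied. *)
Lemma induced_copy_seq n (r : rel 'I_n) (r' : rel nat) (E NE : seq (nat * nat)) x0 xs :
  (forall i j, r i j = r' (val i) (val j)) ->
  all (fun ij => ij \in (if r' ij.1 ij.2 || r' ij.2 ij.1 then E else NE)) (nat_pairs n) ->
  size xs = n -> uniq xs ->
  all (fun ij => nth x0 xs ij.1 -- nth x0 xs ij.2) E ->
  all (fun ij => ~~ (nth x0 xs ij.1 -- nth x0 xs ij.2)) NE ->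
  induced_copy (graph_of_rel r) G.
Proof.
move=> rE /allP edges sxs xsU /allP EP /allP NEP.
exists (fun i : 'I_n => nth x0 xs i) => [i j /eqP|].
  by rewrite nth_uniq ?sxs ?ltn_ord // => /eqP /val_inj.
have main (i j : 'I_n) : i < j ->
    (nth x0 xs i -- nth x0 xs j) = @sedge (graph_of_rel r) i j.
  move=> ij; rewrite /= /symirr_rel !rE -val_eqE neq_ltn ij /=.
  have := edges (nat_of_ord i, nat_of_ord j).
  case: ifP => _ /= => [/(_ _)/EP|/(_ _)/NEP/negbTE]; apply;
    by apply/allpairsPdep; exists (val j), (val i); rewrite !mem_iota /= !add0n.
move=> i j; case: (ltngtP i j) => [|ji|/val_inj ->]; first exact: main.
  by rewrite sedge_sym main // sedge_sym.
by rewrite !sedge_irrefl.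
Qed.

Lemma induced_copy_edges n S (E NE : seq (nat * nat)) x0 xs :
  all (fun ij => ij \in (if (ij \in S) || ((ij.2, ij.1) \in S) then E else NE))
    (nat_pairs n) ->
  size xs = n -> uniq xs ->
  all (fun ij => nth x0 xs ij.1 -- nth x0 xs ij.2) E ->
  all (fun ij => ~~ (nth x0 xs ij.1 -- nth x0 xs ij.2)) NE ->
  induced_copy (graph_of_edges n S) G.
Proof.
move=> EP; apply: (@induced_copy_seq _ _ (fun i j => (i, j) \in S)) => //.
by apply: sub_all EP => -[i j].
Qed.

Hypothesis frG : free_of F3ch G.

Lemma no_K4 a b c d : a -- b -> a -- c -> a -- d -> b -- c -> b -- d -> c -- d -> False.
Proof.
move=> ab ac ad bc bd cd; apply: (frG F3ch_K4).
apply: (@induced_copy_seq 4 _ (fun i j => i != j) (nat_pairs 4) [::] a [:: a; b; c; d]) => //.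
  by conj_adj.
by conj_adj.
Qed.

Lemma no_kite s t l m w :
  s -- t -> l -- s -> l -- t -> m -- s -> m -- t -> m -- w ->
  ~~ (l -- m) -> ~~ (w -- s) -> ~~ (w -- t) -> ~~ (w -- l) ->
  l != m -> w != s -> w != t -> w != l -> False.
Proof.
move=> *; apply: (frG F3ch_kite).
apply: (@induced_copy_edges 5 _
  [:: (1, 2); (0, 1); (0, 2); (1, 3); (2, 3); (3, 4)]
  [:: (0, 3); (0, 4); (1, 4); (2, 4)] l [:: l; s; t; m; w]) => //.
- by conj_adj.
- by conj_adj.
- by conj_adj.
Qed.

Lemma no_gem h a b c d :
  h -- a -> h -- b -> h -- c -> h -- d -> a -- b -> b -- c -> c -- d ->
  ~~ (a -- c) -> ~~ (a -- d) -> ~~ (b -- d) -> a != c -> a != d -> b != d -> False.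
Proof.
move=> *; apply: (frG F3ch_gem).
apply: (@induced_copy_edges 5 _
  [:: (0, 1); (1, 2); (2, 3); (0, 4); (1, 4); (2, 4); (3, 4)]
  [:: (0, 2); (0, 3); (1, 3)] h [:: a; b; c; d; h]) => //.
- by conj_adj.
- by conj_adj.
- by conj_adj.
Qed.

Lemma no_X127 v a b c d (a' b' : G) :
  v -- a -> v -- b -> a -- b -> v -- c -> v -- d -> c -- d -> a -- a' -> b -- b' ->
  all (fun xy => ~~ (xy.1 -- xy.2) && (xy.1 != xy.2))
    [:: (a, c); (a, d); (b, c); (b, d); (a', v); (a', b); (a', c); (a', d);
        (a', b'); (b', v); (b', a); (b', c); (b', d)] -> False.
Proof.
move=> va vb ab vc vd cd aa' bb' /=.
do 13![case/andP => /andP[? ?]]; move=> _; apply: (frG F3ch_X127).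
apply: (@induced_copy_edges 7 _
  [:: (0, 1); (0, 2); (1, 2); (0, 3); (0, 4); (3, 4); (1, 5); (2, 6)]
  [:: (1, 3); (1, 4); (2, 3); (2, 4); (0, 5); (2, 5); (3, 5); (4, 5); (5, 6);
      (0, 6); (1, 6); (3, 6); (4, 6)] v [:: v; a; b; c; d; a'; b']) => //.
- by conj_adj.
- by conj_adj.
- by conj_adj.
Qed.

End SmallCopies.

(** * Diamonds and pairs of triangles *)
Section LocalStructure.
Variable G : sgraph.
Implicit Types (a b c d h l m r s t u v w x y z : G).

Lemma degree2_adj x u v w : degree x = 2 -> x -- u -> x -- v -> u != v ->
  x -- w -> w = u \/ w = v.
Proof.
move=> dx xu xv uv xw.
suff : w \in [set u; v] by rewrite !inE => /orP[]/eqP; [left|right].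
have /setP/(_ w) : [set u; v] = [set y | x -- y].
  by apply/eqP; rewrite eqEcard cards2 uv -/(degree x) dx andbT subUset !sub1set !inE xu.
by rewrite [in RHS]inE xw.
Qed.

Lemma degree2I x u v : x -- u -> x -- v -> u != v ->
  (forall w, x -- w -> w = u \/ w = v) -> degree x = 2.
Proof.
move=> xu xv uv only; rewrite /degree.
have -> : [set y | x -- y] = [set u; v]; last by rewrite cards2 uv.
apply/setP=> w; rewrite !inE; apply/idP/orP => [/only[]->|[]/eqP-> //]; rewrite ?eqxx;
  by [left|right].
Qed.

Lemma degree_ne2_adj x u v : x -- u -> x -- v -> u != v -> degree x != 2 ->
  exists w, [/\ x -- w, w != u & w != v].
Proof.
move=> xu xv uv dx.
have [/existsP[w /and3P[? ? ?]]|/existsPn none] :=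
  boolP [exists w, [&& x -- w, w != u & w != v]]; first by exists w.
case/eqP: dx; apply: degree2I uv _ => // w xw.
by have := none w; rewrite xw /= negb_and !negbK => /orP[]/eqP; [left|right].
Qed.

Hypothesis chG : chordal G.

Lemma chordal_C4 a b c d : a -- b -> b -- c -> c -- d -> d -- a -> b != d ->
  ~~ (a -- c) -> a != c -> b -- d.
Proof.
move=> ab bc cd da bd nac ac.
apply: (chordal_detour chG (A := [set b; c; d]) ab) => //; first by rewrite sedge_sym.
- by rewrite !inE !negb_or; do ?(apply/andP; split); adj.
- by apply: (@con_trans _ _ c); apply: con1; rewrite ?inE ?eqxx ?orbT.
- move=> z; rewrite !inE -orbA => /or3P[]/eqP-> //; try by [left|right].
  by rewrite (negbTE nac).
Qed.

Hypothesis frG : free_of F3ch G.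

(** A further neighbour [w] of the apex [m] would give [K4] if adjacent to both
    [s] and [t], a gem or an induced four-cycle through the other apex [l] if
    adjacent to one of them, and a kite or an induced four-cycle if adjacent to
    neither. *)
Lemma diamond_adj s t l m w : s -- t -> l -- s -> l -- t -> m -- s -> m -- t ->
  l != m -> m -- w -> w = s \/ w = t.
Proof.
move=> st ls lt ms mt nlm mw.
have lm : ~~ (l -- m).
  by apply/negP => lm; apply: (no_K4 frG st (_ : s -- l) (_ : s -- m)); rewrite // sedge_sym.
have [->|ws] := eqVneq w s; first by left.
have [->|wt] := eqVneq w t; [by right|exfalso].
have wl : w != l by apply: contraNneq lm => <-; rewrite sedge_sym.
have half s' t' : s' -- t' -> l -- s' -> l -- t' -> m -- s' -> m -- t' ->
    w != s' -> w != t' -> w -- s' -> False.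
  move=> *; have [wt'|wt'] := boolP (w -- t').
    by apply: (no_K4 frG (_ : s' -- t') (_ : s' -- m) (_ : s' -- w)); adj.
  have [wl'|wl'] := boolP (w -- l).
    have : l -- m by apply: (@chordal_C4 w l t' m); adj.
    by rewrite (negbTE lm).
  by apply: (no_gem frG (_ : s' -- w) (_ : s' -- m) (_ : s' -- t') (_ : s' -- l)); adj.
have [ws'|ws'] := boolP (w -- s); first exact: (half s t).
have [wt'|wt'] := boolP (w -- t); first by apply: (half t s); adj.
have [wl'|wl'] := boolP (w -- l).
  have : l -- m by apply: (@chordal_C4 w l s m); adj.
  by rewrite (negbTE lm).
by apply: (no_kite frG st ls lt ms mt mw); adj.
Qed.

Lemma diamond_degree2 s t l m : s -- t -> l -- s -> l -- t -> m -- s -> m -- t ->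
  l != m -> degree m = 2.
Proof.
move=> st ls lt ms mt nlm; apply: (degree2I ms mt); first adj.
by move=> w mw; apply: (diamond_adj st ls lt ms mt nlm mw).
Qed.

(** Otherwise [a] and [b] have outer neighbours [a'] and [b'], which together
    with the two triangles form [X127]; all other adjacencies among these
    vertices would create a diamond with an apex of degree at least three, or
    an induced four-cycle. *)
Lemma two_triangles_degree2 r a b c d :
  r -- a -> r -- b -> a -- b -> r -- c -> r -- d -> c -- d ->
  a != c -> a != d -> b != c -> b != d -> degree a = 2 \/ degree b = 2.
Proof.
move=> ra rb ab rc rd cd nac nad nbc nbd.
have [/eqP|da] := boolP (degree a == 2); first by left.
have [/eqP|db] := boolP (degree b == 2); [by right|exfalso].
have ar : a -- r by rewrite sedge_sym.
have br : b -- r by rewrite sedge_sym.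
have ba : b -- a by rewrite sedge_sym.
have nrb : r != b by adj.
have nra : r != a by adj.
have [a' [aa' a'r a'b]] := degree_ne2_adj ar ab nrb da.
have [b' [bb' b'r b'a]] := degree_ne2_adj br ba nra db.
(* The situation is symmetric in the two sides [a, a'] and [b, b'] and in [c]
   and [d]; this covers one side [x, x'] against one vertex [z]. *)
have half x y x' z : r -- x -> r -- y -> x -- y -> x != z -> y != z -> r -- z ->
    degree y != 2 -> x -- x' -> x' != r -> x' != y ->
    [/\ ~~ (x -- z), ~~ (x' -- r), ~~ (x' -- y), ~~ (x' -- z) & x' != z].
  move=> rx ry xy nxz nyz rz dy xx' nx'r nx'y.
  have xz : ~~ (x -- z).
    apply: contra dy => xz; apply/eqP.
    by apply: (@diamond_degree2 r x z y); adj.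
  have x'r : ~~ (x' -- r).
    apply: contra dy => x'r; apply/eqP.
    by apply: (@diamond_degree2 r x x' y); adj.
  have nx'z : x' != z by apply: contraNneq xz => <-.
  split=> //.
    apply/negP => x'y.
    have : z = x \/ z = y by apply: (@diamond_adj x y x' r); adj.
    by case=> E; [move: nxz | move: nyz]; rewrite E eqxx.
  apply: contra xz => x'z; apply: (@chordal_C4 x' x r z); adj.
have [a1 a2 a3 a4 a5] := half a b a' c ra rb ab nac nbc rc db aa' a'r a'b.
have [a6 _ _ a7 a8] := half a b a' d ra rb ab nad nbd rd db aa' a'r a'b.
have [b1 b2 b3 b4 b5] := half b a b' c rb ra ba nbc nac rc da bb' b'r b'a.
have [b6 _ _ b7 b8] := half b a b' d rb ra ba nbd nad rd da bb' b'r b'a.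
have na'b' : a' != b' by apply: contraNneq a3 => ->; rewrite sedge_sym.
have a'b' : ~~ (a' -- b').
  by apply: contra a3 => a'b'; apply: (@chordal_C4 a a' b' b); adj.
apply: (no_X127 frG ra rb ab rc rd cd aa' bb').
by rewrite /=; do !(apply/andP; split).
Qed.

End LocalStructure.

(** * The distance of a connected graph *)
(** The bound [d] is not a unit of [minn], so these minima are not iterations of a
    monoid law. *)
Section BigMinn.
Variables (I : finType) (P : pred I) (F : I -> nat) (d : nat).

Lemma bigminn_le i : P i -> \big[minn/d]_(j | P j) F j <= F i.
Proof.
move=> Pi; have := mem_index_enum i; elim: (index_enum I) => // j r IH.
rewrite big_cons inE => /orP[/eqP<-|/IH le]; first by rewrite Pi geq_minl.
by case: ifP => // _; rewrite geq_min le orbT.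
Qed.

Lemma bigminn_attained :
  (exists2 i, P i & \big[minn/d]_(j | P j) F j = F i)
  \/ \big[minn/d]_(j | P j) F j = d.
Proof.
elim/big_rec: _ => [|i x Pi IH]; first by right.
by rewrite /minn; case: ifP => _ //; left; exists i.
Qed.

Lemma bigminn_le_idx : \big[minn/d]_(j | P j) F j <= d.
Proof. by elim/big_rec: _ => // i x _ le; rewrite geq_min le orbT. Qed.

End BigMinn.

Section Distance.
Variable G : sgraph.
Implicit Types (x y z w r : G) (A B : {set G}) (p : seq G).

Lemma dist_le x p : path (@sedge G) x p -> dist x (last x p) <= size p.
Proof.
move=> pP; have [lt|ge] := ltnP (size p) #|G|; last first.
  exact: leq_trans (bigminn_le_idx _ _ _) ge.
apply: (@bigminn_le _ _ _ _ (Ordinal lt)); apply/existsP.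
by exists (in_tuple p); rewrite /= pP eqxx.
Qed.

Lemma dist_adj x y : x -- y -> dist x y <= 1.
Proof. by move=> xy; apply: (@dist_le x [:: y]); rewrite /= xy. Qed.

Lemma dist0 x : dist x x = 0.
Proof. by apply/eqP; rewrite -leqn0; apply: (@dist_le x [::]). Qed.

Lemma dist_neq x y : 0 < dist x y -> x != y.
Proof. by apply: contraTneq => ->; rewrite dist0. Qed.

Hypothesis conG : connected_graph G.

Lemma dist_path x y : exists p, [/\ path (@sedge G) x p, last x p = y & size p = dist x y].
Proof.
have [p sp] := shortest_exists (conG x y); have [pP py pmin] := sp.
have pG : size p < #|G|.
  by have /card_uniqP/= <- := shortest_uniq sp; apply: max_card.
have [|dE] := @bigminn_attained 'I_#|G|
  (fun n : 'I_#|G| => [exists p : n.-tuple G, path (@sedge G) x p && (last x p == y)]) val #|G|.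
  case=> n /existsP[q /andP[qP /eqP qy]] dE; exists q; split=> //.
  by rewrite size_tuple; symmetry; exact: dE.
by have := dist_le pP; rewrite py /dist; move: dE; rewrite /= => ->; rewrite leqNgt pG.
Qed.

Lemma dist_triangle x y z : dist x z <= dist x y + dist y z.
Proof.
have [p [pP py <-]] := dist_path x y; have [q [qP qz <-]] := dist_path y z.
rewrite -size_cat -qz -[y in last y]py -last_cat; apply: dist_le.
by rewrite cat_path pP py.
Qed.

Lemma dist_sym x y : dist x y = dist y x.
Proof.
suff le (u v : G) : dist v u <= dist u v by apply/eqP; rewrite eqn_leq !le.
have [p [pP <- <-]] := dist_path u v.
have uE : last (last u p) (rev (belast u p)) = u.
  by case: p {pP} => //= a p; rewrite rev_cons last_rcons.
have : path (@sedge G) (last u p) (rev (belast u p)).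
  by rewrite rev_path (eq_path (e' := @sedge G)) // => a b; rewrite sedge_sym.
by move=> /dist_le; rewrite uE size_rev size_belast.
Qed.

Lemma dist_eq0 x y : dist x y = 0 -> x = y.
Proof. by have [[|a p] [_ <- <-]] := dist_path x y. Qed.

Lemma dist_step r x y : x -- y -> dist r y <= (dist r x).+1.
Proof.
by move=> xy; rewrite -addn1 (leq_trans (dist_triangle r x y)) // leq_add2l dist_adj.
Qed.

Lemma dist_pred r y : y != r -> exists2 x, x -- y & dist r y = (dist r x).+1.
Proof.
move=> yr; have [p [pP py ps]] := dist_path r y.
case/lastP: p pP py ps => [|p z]; first by move=> _ /= ry; rewrite ry eqxx in yr.
rewrite rcons_path last_rcons size_rcons => /andP[pP lz] zy ps.
rewrite zy in lz; exists (last r p) => //; apply/eqP.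
by rewrite eqn_leq dist_step //= -ps ltnS dist_le.
Qed.

Lemma set_dist_le A B x p : x \in A -> last x p \in B -> path (@sedge G) x p ->
  set_dist A B <= size p.
Proof.
move=> xA yB pP; apply: leq_trans (dist_le pP).
by apply: leq_trans (bigminn_le _ _ xA) (bigminn_le _ _ yB).
Qed.

Lemma set_dist_le_dist A B x y : x \in A -> y \in B -> set_dist A B <= dist x y.
Proof.
by move=> xA yB; have [p [pP py <-]] := dist_path x y; apply: (@set_dist_le _ _ x); rewrite ?py.
Qed.

Lemma dist_lt x y : dist x y < #|G|.
Proof.
have [p sp] := shortest_exists (conG x y); have [pP <- _] := sp.
apply: leq_ltn_trans (dist_le pP) _.
by have /card_uniqP/= <- := shortest_uniq sp; apply: max_card.
Qed.

Lemma joining_path_exists A B x0 y0 : x0 \in A -> y0 \in B ->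
  exists x p, joining_path A B x p.
Proof.
move=> x0A y0B.
have lt : set_dist A B < #|G|.
  by apply: leq_ltn_trans (set_dist_le_dist x0A y0B) (dist_lt _ _).
have [[x xA E1]|] := bigminn_attained (mem A)
  (fun x => \big[minn/#|G|]_(y in B) dist x y) #|G|; last first.
  by move=> E; move: lt; rewrite /set_dist E ltnn.
have [[y yB E2]|] := bigminn_attained (mem B) (dist x) #|G|; last first.
  by move=> E; move: lt; rewrite /set_dist E1 E ltnn.
have [p [pP py ps]] := dist_path x y.
by exists x, p; split; rewrite ?py // ps /set_dist E1.
Qed.

End Distance.

(** * Two disjoint triangles and a shortest path between them *)
Section LinkedTriangles.
Variable G : sgraph.
Hypotheses (conG : connected_graph G) (chG : chordal G) (frG : free_of F3ch G).
Implicit Types (a b c d q x y z w : G) (P : nat -> G).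

(** [P 0, ..., P m] is a shortest path between the triangles [P 0, a, b] and
    [P m, c, d]. Vertices are indexed by numbers, as a function, so that
    reversing the path or cutting off an end is a reindexing. *)
Definition linked m P a b c d : Prop :=
  [/\ 0 < m, (forall i, i < m -> P i -- P i.+1),
    [/\ P 0 -- a, P 0 -- b & a -- b], [/\ P m -- c, P m -- d & c -- d]
    & forall x y, x \in [:: P 0; a; b] -> y \in [:: P m; c; d] -> m <= dist x y].

Lemma linked_rev m P a b c d :
  linked m P a b c d -> linked m (fun i => P (m - i)) c d a b.
Proof.
case=> m0 path [? ? ?] [? ? ?] far; split=> //; rewrite ?subn0 ?subnn //.
  by move=> i im; rewrite sedge_sym (_ : m - i = (m - i.+1).+1); [apply: path|]; lia.
by move=> x y xT yT; rewrite dist_sym //; apply: far.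
Qed.

Lemma linked_swap m P a b c d : linked m P a b c d -> linked m P b a c d.
Proof.
case=> m0 path [? ? ab] T2 far; split=> //; first by rewrite (sedge_sym b).
by move=> x y; rewrite !inE [(x == b) || _]orbC => *; apply: far; rewrite ?inE.
Qed.

Lemma path_dist_le m P i j : (forall i, i < m -> P i -- P i.+1) -> i <= j <= m ->
  dist (P i) (P j) <= j - i.
Proof.
move=> path /andP[]; elim: j => [|j IH]; first by rewrite leqn0 => /eqP->; rewrite dist0.
rewrite leq_eqVlt => /orP[/eqP->|]; first by rewrite dist0.
rewrite ltnS => ij jm; rewrite subSn //.
by apply: leq_trans (dist_step conG _ (path _ jm)) _; rewrite ltnS IH // ltnW.
Qed.

Lemma linked_far m P a b c d x j : linked m P a b c d ->
  x \in [:: P 0; a; b] -> j <= m -> j <= dist x (P j).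
Proof.
case=> m0 path _ _ far xT jm.
have := far x (P m) xT; rewrite !inE eqxx => /(_ isT).
have := dist_triangle conG x (P j) (P m).
have := path_dist_le path (_ : j <= m <= m); rewrite jm leqnn => /(_ isT).
lia.
Qed.

Lemma linked_dist m P a b c d i j : linked m P a b c d -> i <= j <= m ->
  dist (P i) (P j) = j - i.
Proof.
move=> L /andP[ij jm]; case: (L) => m0 path _ _ _; apply/eqP.
rewrite eqn_leq (path_dist_le path) ?ij //=.
have := linked_far L (mem_head _ _) jm.
have := dist_triangle conG (P 0) (P i) (P j).
have := path_dist_le path (_ : 0 <= i <= m); rewrite (leq_trans ij jm) => /(_ isT).
lia.
Qed.

Lemma linked_adj m P a b c d i j : linked m P a b c d -> i < j <= m ->
  P i != P j /\ (P i -- P j) = (j == i.+1).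
Proof.
move=> L /andP[ij jm]; have dE := linked_dist L (_ : i <= j <= m).
split; first by apply: dist_neq; rewrite dE ?(ltnW ij) //; lia.
apply/idP/eqP => [/dist_adj|->]; first by rewrite dE ?(ltnW ij) //; lia.
by case: L => _ path _ _ _; apply: path; lia.
Qed.

(** Only adjacency of [a] to [P 1] is compatible with the distances. It would
    make [P 1] an apex of the diamond with base [P 0], [a], but the path or the
    second triangle gives [P 1] yet another neighbour. *)
Lemma linked_corner_far m P a b c d j : linked m P a b c d -> 0 < j <= m ->
  a != P j /\ ~~ (a -- P j).
Proof.
move=> L /andP[j0 jm].
have aT : a \in [:: P 0; a; b] by rewrite !inE eqxx orbT.
have bT : b \in [:: P 0; a; b] by rewrite !inE eqxx !orbT.
have := linked_far L aT jm; move=> far; split; first by apply: dist_neq; lia.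
apply/negP => aP; move: far => /leq_trans/(_ (dist_adj aP)) j1.
have {}j1 : j = 1 by lia.
subst j; case: (L) => m0 path [Pa Pb ab] [Pc Pd cd] farT.
have nbP : b != P 1 by apply: dist_neq; have := linked_far L bT jm; lia.
have no w : P 1 -- w -> w != P 0 -> w != a -> False.
  move=> Pw w0 wa; have := @diamond_adj _ chG frG (P 0) a b (P 1) w.
  case; try adj; rewrite ?(sedge_sym (P 1)) ?path //.
  - by move/eqP; rewrite (negbTE w0).
  - by move/eqP; rewrite (negbTE wa).
have [m1|m1] := eqVneq m 1.
  subst m; apply: (no c) => //; rewrite eq_sym; apply: dist_neq; apply: farT;
    by rewrite ?inE ?eqxx ?orbT.
have m2 : 2 <= m by lia.
apply: (no (P 2)); rewrite ?path // eq_sym; apply: dist_neq.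
  by rewrite (linked_dist L).
by have := linked_far L aT m2; lia.
Qed.

Lemma nat_path_con (A : {set G}) P i j : (forall k, i <= k < j -> P k -- P k.+1) ->
  (forall k, i <= k <= j -> P k \in A) -> i <= j -> con A (P i) (P j).
Proof.
elim: j => [|j IH] path inA; first by rewrite leqn0 => /eqP->; apply: con0.
rewrite leq_eqVlt => /orP[/eqP->|]; first exact: con0.
rewrite ltnS => ij; apply: (@con_trans _ _ (P j)); last first.
  by apply: con1; [apply: inA|apply: inA|apply: path]; lia.
by apply: IH => // k kj; [apply: path|apply: inA]; lia.
Qed.

Definition segment P i j : {set G} := [set P (val k) | k : 'I_j.+1 & i <= k].

Lemma segmentP P i j x :
  reflect (exists2 k, i <= k <= j & x = P k) (x \in segment P i j).
Proof.
apply: (iffP imsetP) => [[k]|[k /andP[ik kj] ->]].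
  by rewrite inE => ik ->; exists (val k); rewrite // ik -ltnS /=.
by exists (Ordinal (kj : k < j.+1)); rewrite ?inE.
Qed.

(** If [a -- q], then [a] would be a vertex seeing only the ends [P 0] and [q]
    of the path [P 0, ..., P i, q]. *)
Lemma linked_rung_corner m P a b c d q i : linked m P a b c d -> 0 < i < m ->
  q -- P i -> q != P 0 -> (forall j, j <= m -> q -- P j -> j = i) ->
  a != q /\ ~~ (a -- q).
Proof.
move=> L /andP[i0 im] qi nq0 only; case: (L) => m0 path [Pa Pb ab] _ _.
have far j : 0 < j <= i -> a != P j /\ ~~ (a -- P j).
  by move=> ji; apply: linked_corner_far L _; lia.
split.
  by apply: contraTneq qi => <-; have [] := far i (_ : 0 < i <= i); rewrite ?i0 /=.
have q0 : ~~ (q -- P 0) by apply/negP => /only -/(_ isT) E; rewrite -E in i0.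
apply/negP => aq; case/negP: q0; rewrite sedge_sym.
apply: (chordal_detour chG (A := q |: segment P 0 i) (w := a)) => //; try adj.
- rewrite !inE negb_or (adj_neq aq) /=; apply/segmentP => -[[|j] /= ji E].
    by move: Pa; rewrite -E sedge_irrefl.
  by case: (far j.+1 ji); rewrite E eqxx.
- apply: (@con_trans _ _ (P i)); last first.
    apply: con1; rewrite ?inE ?eqxx //; last adj.
    by apply/orP; right; apply/segmentP; exists i; rewrite ?leqnn.
  apply: nat_path_con => // k ki; first by apply: path; lia.
  by rewrite inE; apply/orP; right; apply/segmentP; exists k.
- move=> z; rewrite !inE => /orP[/eqP->|/segmentP[[|j] ji ->]] az; [by right|by left|].
  by case: (far j.+1 ji); rewrite az.
Qed.

End LinkedTriangles.

Section LinkedTrianglesCopy.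
Variable G : sgraph.
Hypotheses (conG : connected_graph G) (chG : chordal G) (frG : free_of F3ch G).
Implicit Types (a b c d q x y z w : G) (P Q : nat -> G).

(** A vertex attached to the path at [P i] only, like the foot of a leg of a
    centipede. *)
Definition rung m P i q : Prop :=
  [/\ q -- P i, (forall j, j <= m -> q != P j)
    & forall j, j <= m -> q -- P j -> j = i].

(** By the distances along the path, [q] can only reach [P j] for [j] within two
    of [i]; distance two would close an induced four-cycle. *)
Lemma rungI m P a b c d i q : linked m P a b c d -> 0 < i < m -> q -- P i ->
  q != P i.-1 -> q != P i.+1 -> ~~ (q -- P i.-1) -> ~~ (q -- P i.+1) ->
  rung m P i q.
Proof.
move=> L /andP[i0 im] qi qp qs nqp nqs.
have adjP j k : j < k <= m -> P j != P k /\ (P j -- P k) = (k == j.+1).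
  by move=> jk; apply: linked_adj L jk.
split=> // j jm.
  apply/eqP => E; case: (ltngtP j i) => [ji|ij|ji].
  - have [_] := adjP j i (introT andP (conj ji (ltnW im))).
    rewrite -E qi => /esym/eqP j1.
    by move: qp; rewrite j1 -E eqxx.
  - have [_] := adjP i j (introT andP (conj ij jm)).
    rewrite -E sedge_sym qi => /esym/eqP j1.
    by move: qs; rewrite -j1 -E eqxx.
  - by move: qi; rewrite E ji sedge_irrefl.
move=> qj; case: (ltngtP j i) => [ji|ij|//]; exfalso.
- have j1 : j != i.-1 by apply: contraTneq qj => ->.
  have := dist_triangle conG (P j) q (P i); rewrite (linked_dist conG L); last by rewrite ltnW //= ltnW.
  have := dist_adj qi; have := dist_adj (_ : P j -- q); rewrite sedge_sym => /(_ qj) d1 d2 d3.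
  have jE : j = i.-2 by lia.
  have [Eji Aji] := adjP j i (introT andP (conj ji (ltnW im))).
  have [E1 A1] := adjP j i.-1 ltac:(clear -jE ji j1 im; lia).
  have [E2 A2] := adjP i.-1 i ltac:(clear -i0 im; lia).
  have : P j -- P i.
    apply: (@chordal_C4 _ chG q (P j) (P i.-1) (P i)) => //; try adj.
      by rewrite A1; clear -jE ji j1; lia.
    by rewrite A2; clear -i0; lia.
  by rewrite Aji; clear -jE ji j1; lia.
- have j1 : j != i.+1 by apply: contraTneq qj => ->.
  have := dist_triangle conG (P i) q (P j); rewrite (linked_dist conG L); last by rewrite ltnW.
  have := dist_adj qj; have := dist_adj (_ : P i -- q); rewrite sedge_sym => /(_ qi) d1 d2 d3.
  have jE : j = i.+2 by lia.
  have [Eji Aji] := adjP i j (introT andP (conj ij jm)).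
  have [E1 A1] := adjP i.+1 j ltac:(clear -jE jm; lia).
  have [E2 A2] := adjP i i.+1 ltac:(clear -im; lia).
  have : P i -- P j.
    rewrite sedge_sym; apply: (@chordal_C4 _ chG q (P j) (P i.+1) (P i)) => //; try adj.
      by rewrite sedge_sym A1; clear -jE; lia.
    by rewrite sedge_sym A2 eqxx.
  by rewrite Aji; clear -jE; lia.
Qed.

(** An edge [a -- c] forces [m = 1], and then [a, c, P 1, P 0] is an induced
    four-cycle. *)
Lemma linked_corners m P a b c d : linked m P a b c d ->
  a != c /\ ~~ (a -- c).
Proof.
move=> L; case: (L) => m0 path [Pa Pb ab] [Pc Pd cd] far.
have farE x y : x \in [:: P 0; a; b] -> y \in [:: P m; c; d] -> x != y.
  by move=> xT yT; apply: dist_neq; apply: leq_trans m0 (far x y xT yT).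
split; first by apply: farE; rewrite !inE eqxx ?orbT.
apply/negP => ac; have := dist_adj ac.
have := far a c; rewrite !inE !eqxx ?orbT => /(_ isT isT) m1 m2.
have {m1 m2} m1 : m = 1 by lia.
subst m; have [nP1 aP1] := linked_corner_far conG chG frG L (isT : 0 < 1 <= 1).
have [_] := linked_corner_far conG chG frG (linked_rev conG L) (isT : 0 < 1 <= 1).
rewrite subnn; case/negP; apply: (@chordal_C4 _ chG a c (P 1) (P 0)) => //; try adj.
- by rewrite sedge_sym path.
- by rewrite eq_sym; apply: farE; rewrite !inE eqxx ?orbT.
Qed.

Lemma linked_swap_end m P a b c d : linked m P a b c d -> linked m P a b d c.
Proof.
case=> m0 path T1 [? ? cd] far; split=> //; first by rewrite (sedge_sym d).
move=> x y xT yT; apply: far => //.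
by move: yT; rewrite !inE => /or3P[]->; rewrite ?orbT.
Qed.

(** With a rung at every interior vertex of the path, the two triangles, the path
    and the rungs form a copy of [D m.+3]. *)
Lemma no_rungs m P Q a b c d : linked m P a b c d ->
  (forall i, 0 < i < m -> rung m P i (Q i)) -> False.
Proof.
move=> L rungs; case: (L) => m0 path [Pa Pb ab] [Pc Pd cd] far.
have Lb := linked_swap L.
(* The spine of the centipede is [a, P 0, ..., P m, c] and its feet are
   [b, Q 1, ..., Q m.-1, d], the first and the last one each being attached to
   two spine vertices. *)
pose U i := if i == 0 then a else if i == m.+2 then c else P i.-1.
pose V j := if j == 0 then b else if j == m then d else Q j.
have revP i : i <= m -> P i = P (m - (m - i)) by move=> im; rewrite subKn.
have rungs' i : 0 < i < m -> [/\ Q i -- P (m - (m - i)), Q i != P (m - 0)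
    & (forall j, j <= m -> Q i -- P (m - j) -> j = m - i)].
  move=> im; have [q1 q2 q3] := rungs i im; split.
  - by rewrite subKn //; lia.
  - by apply: q2; lia.
  - by move=> j jm /q3; lia.
have UP i : 0 < i <= m.+1 -> U i = P i.-1.
  by rewrite /U => ?; case: eqP => [?|_]; [lia|case: eqP => [?|//]; lia].
have Uc : U m.+2 = c by rewrite /U eqxx.
have Vd : V m = d by rewrite /V eqxx; case: eqP => // ?; lia.
have VQ j : 0 < j < m -> V j = Q j.
  by rewrite /V => ?; case: eqP => [?|_]; [lia|case: eqP => [?|//]; lia].
(* The letters 0 and m tell at which end of the path the corner lies. The end
   [m] is reduced to the end 0 by reversing the path. *)
have c0P x y i : linked m P x y c d -> 1 < i <= m.+1 -> x != U i /\ ~~ (x -- U i).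
  move=> L' im; rewrite UP; last lia.
  by apply: (linked_corner_far conG chG frG L'); lia.
have cmP x y i : linked m P a b x y -> 0 < i <= m -> U i != x /\ ~~ (U i -- x).
  move=> L' im; rewrite UP; last lia.
  rewrite eq_sym sedge_sym revP; last lia.
  by apply: (linked_corner_far conG chG frG (linked_rev conG L')); lia.
have c0Q x y i : linked m P x y c d -> 0 < i < m -> x != Q i /\ ~~ (x -- Q i).
  move=> L' im; have [q1 q2 q3] := rungs i im.
  by apply: (linked_rung_corner conG chG frG L' im) => //; apply: q2.
have cmQ x y i : linked m P a b x y -> 0 < i < m -> Q i != x /\ ~~ (Q i -- x).
  move=> L' im; have [q1 q2 q3] := rungs' i im.
  rewrite eq_sym sedge_sym.
  by apply: (linked_rung_corner conG chG frG (linked_rev conG L') (_ : 0 < m - i < m)) => //; lia.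
have Ldd : linked m P a b d c by exact: linked_swap_end.
have Lbd : linked m P b a d c by exact: linked_swap_end.
have UU i j : i < j <= m.+2 -> U i != U j /\ (U i -- U j) = (j == i.+1).
  case/andP=> ij jm; case: (posnP i) => [i0|i0].
    subst i; have U0 : U 0 = a by []. rewrite U0.
    have [->|j1] := eqVneq j 1; first by rewrite UP //= sedge_sym Pa; split=> //; adj.
    have [->|jm2] := eqVneq j m.+2.
      by rewrite Uc; have [-> /negbTE->] := linked_corners L; split=> //; apply/esym/negbTE; lia.
    have [-> /negbTE->] := c0P _ _ j L ltac:(lia); split=> //; apply/esym/negbTE; lia.
  have [jE|jm2] := eqVneq j m.+2.
    subst j; rewrite Uc; have [->|im] := eqVneq i m.+1.
      by rewrite UP /= ?ltnSn // eqxx; split=> //; adj.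
    by have [-> /negbTE->] := cmP _ _ i L ltac:(lia); split=> //; apply/esym/negbTE; lia.
  rewrite !UP; try lia.
  have [-> ->] := linked_adj conG L (ltac:(lia) : i.-1 < j.-1 <= m).
  by split=> //; apply/eqP/eqP; lia.
have UV i j : i <= m.+2 -> j <= m -> U i != V j /\ (U i -- V j) = (minn i.-1 m == j).
  move=> im jm; case: (posnP j) => [j0|j0].
    subst j; have V0 : V 0 = b by []. rewrite V0.
    have [->|i0] := eqVneq i 0; first by rewrite /U min0n; split=> //; adj.
    have [->|i1] := eqVneq i 1; first by rewrite UP //= min0n; split=> //; adj.
    have [->|im2] := eqVneq i m.+2.
      rewrite Uc; have [] := linked_corners Lb; rewrite eq_sym sedge_sym => -> /negbTE->.
      by split=> //; apply/esym/negbTE; lia.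
    have [] := c0P _ _ i Lb ltac:(lia); rewrite eq_sym sedge_sym => -> /negbTE->.
    by split=> //; apply/esym/negbTE; lia.
  have [jE|jm2] := eqVneq j m.
    subst j; rewrite Vd.
    have [->|i0] := eqVneq i 0.
      rewrite {1 2}/U /=; have [-> /negbTE->] := linked_corners Ldd.
      by split=> //; apply/esym/negbTE; lia.
    have [->|i1] := eqVneq i m.+1.
      by rewrite UP /= ?ltnSn // minnn eqxx; split=> //; adj.
    have [->|im2] := eqVneq i m.+2.
      by rewrite Uc (_ : minn _ _ = m) ?eqxx; [split=> //; adj|lia].
    have [-> /negbTE->] := cmP _ _ i Ldd ltac:(lia); split=> //; apply/esym/negbTE; lia.
  have jj : 0 < j < m by lia.
  rewrite VQ //; have [q1 q2 q3] := rungs j jj.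
  have [->|i0] := eqVneq i 0.
    rewrite {1 2}/U /=; have [-> /negbTE->] := c0Q _ _ j L jj.
    by split=> //; apply/esym/negbTE; lia.
  have [->|im2] := eqVneq i m.+2.
    rewrite Uc; have [] := cmQ _ _ j L jj; rewrite eq_sym sedge_sym => -> /negbTE->.
    by split=> //; apply/esym/negbTE; lia.
  rewrite UP; last lia.
  split; first by rewrite eq_sym q2 //; lia.
  rewrite sedge_sym (_ : minn _ _ = i.-1); last lia.
  by apply/idP/eqP => [/q3->|->] //; lia.
have VV i j : i < j <= m -> V i != V j /\ ~~ (V i -- V j).
  case/andP=> ij jm; case: (posnP i) => [i0|i0].
    subst i; have V0 : V 0 = b by []. rewrite V0.
    have [->|jm2] := eqVneq j m; first by rewrite Vd; apply: linked_corners Lbd.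
    by rewrite VQ; [apply: c0Q Lb _|]; lia.
  have [->|jm2] := eqVneq j m; first by rewrite Vd VQ; [apply: cmQ Ldd _|]; lia.
  rewrite !VQ; try lia.
  have [p1 p2 p3] := rungs i ltac:(lia); have [q1 q2 q3] := rungs j ltac:(lia).
  split; first by apply: contraTneq p1 => ->; apply/negP => /q3; lia.
  apply/negP => qq.
  (* [Q i] sees only the ends of the path [P i, ..., P j, Q j]. *)
  have : P i -- Q j.
    apply: (chordal_detour chG (A := Q j |: segment P i j) (w := Q i)) => //.
    - by rewrite eq_sym q2 //; clear -ij jm; lia.
    - rewrite !inE negb_or (adj_neq qq) /=; apply/segmentP => -[k kj E].
      by have := p2 k; rewrite E eqxx => /(_ ltac:(clear -kj jm; lia)).
    - apply: (@con_trans _ _ (P j)); last first.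
        apply: con1; rewrite ?inE ?eqxx //; last adj.
        by apply/orP; right; apply/segmentP; exists j; rewrite ?leqnn ?(ltnW ij).
      apply: nat_path_con => // [k ki||]; [by apply: path; clear -ki jm; lia| |exact: ltnW].
      by move=> k kj; rewrite inE; apply/orP; right; apply/segmentP; exists k.
    - move=> z; rewrite !inE => /orP[/eqP->|/segmentP[k kj ->]] az; [by right|left].
      by rewrite (p3 k _ az) //; clear -kj jm; lia.
  rewrite sedge_sym => /q3; clear -ij jm; lia.
apply: (frG (@F3ch_D m.+3 _)); first lia.
pose f (x : D m.+3) : G := match x with inl i => U (val i) | inr j => V (val j) end.
have k3 : m.+3 - 3 = m by lia.
have inr_lt (j : 'I_(m.+3 - 2)) : j <= m by have := ltn_ord j; lia.
have UUi (i j : 'I_m.+3) : i < j -> U i != U j /\ (U i -- U j) = (i.+1 == j).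
  by move=> ij; rewrite [_ == nat_of_ord j]eq_sym; apply: UU; rewrite ij -ltnS ltn_ord.
have UVi (i : 'I_m.+3) (j : 'I_(m.+3 - 2)) :
    U i != V j /\ (U i -- V j) = (minn i.-1 (m.+3 - 3) == j).
  by rewrite k3; apply: UV; rewrite // -ltnS ltn_ord.
have VVi (i j : 'I_(m.+3 - 2)) : i < j -> V i != V j /\ ~~ (V i -- V j).
  by move=> ij; apply: VV; rewrite ij inr_lt.
exists f.
  case=> [i|i] [j|j] /= /eqP.
  - case: (ltngtP i j) => [/UUi[/negbTE->]|/UUi[]|/val_inj->] //.
    by rewrite eq_sym => /negbTE->.
  - by have [/negbTE->] := UVi i j.
  - by have [] := UVi j i; rewrite eq_sym => /negbTE->.
  - case: (ltngtP i j) => [/VVi[/negbTE->]|/VVi[]|/val_inj->] //.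
    by rewrite eq_sym => /negbTE->.
have inlE (i j : 'I_m.+3) : ((inl i : 'I_m.+3 + 'I_(m.+3 - 2)) == inl j) = (i == j) by [].
case=> [i|i] [j|j]; rewrite /= /symirr_rel /=.
- rewrite inlE -val_eqE /=; case: (ltngtP i j) => [ij|ij|/val_inj->] /=.
  + by have [_ ->] := UUi _ _ ij; rewrite [_ == nat_of_ord i](_ : _ = false) ?orbF //; lia.
  + by rewrite sedge_sym; have [_ ->] := UUi _ _ ij; rewrite [_ == nat_of_ord j](_ : _ = false) //; lia.
  + by rewrite sedge_irrefl.
- by have [_ ->] := UVi i j; rewrite orbF.
- by rewrite sedge_sym; have [_ ->] := UVi j i.
- rewrite andbF; case: (ltngtP i j) => [/VVi[_ /negbTE]|/VVi[_ /negbTE]|/val_inj->] //.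
    by rewrite sedge_sym.
  by rewrite sedge_irrefl.
Qed.

(** A neighbour [q] of both [P i] and [P i.-1] gives a triangle that is nearer to
    the second triangle than the first one is, along the same path. *)
Lemma linked_suffix m P a b c d i q : linked m P a b c d -> 0 < i < m ->
  P i -- q -> q -- P i.-1 -> linked (m - i) (fun k => P (k + i)) (P i.-1) q c d.
Proof.
case=> m0 path T1 T2 far /andP[i0 im] iq qi1.
have pred_i : P i -- P i.-1.
  by rewrite sedge_sym -[i in X in _ -- X](prednK i0); apply: path; clear -i0 im; lia.
have le1 : dist (P 0) (P i) <= i.
  by have := path_dist_le conG path (_ : 0 <= i <= m); rewrite (ltnW im) subn0 => /(_ isT).
have le2 : dist (P 0) (P i.-1) <= i.-1.
  have := path_dist_le conG path (_ : 0 <= i.-1 <= m).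
  by rewrite subn0; apply; clear -im; lia.
have le3 : dist (P 0) q <= i.
  rewrite sedge_sym in qi1; have := dist_step conG (P 0) qi1; clear -le2 i0; lia.
split; rewrite ?add0n ?(subnK (ltnW im)) //.
- by rewrite subn_gt0.
- by move=> k km; rewrite addSn; apply: path; clear -km; lia.
- by split=> //; rewrite sedge_sym.
move=> x y xT yT.
have le : dist (P 0) x <= i.
  by move: xT; rewrite !inE => /or3P[]/eqP-> //; apply: leq_trans le2 (leq_pred _).
have := far (P 0) y (mem_head _ _) yT.
have := dist_triangle conG (P 0) x y; clear -le; lia.
Qed.

Lemma linked_prefix m P a b c d i q : linked m P a b c d -> 0 < i < m ->
  P i -- q -> q -- P i.+1 -> linked i P a b (P i.+1) q.
Proof.
case=> m0 path T1 T2 far /andP[i0 im] iq qi1.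
have le1 : dist (P i) (P m) <= m - i.
  by apply: (path_dist_le conG path); rewrite (ltnW im) leqnn.
have le2 : dist (P i.+1) (P m) <= m - i.+1.
  by apply: (path_dist_le conG path); rewrite im leqnn.
have le3 : dist q (P m) <= m - i.
  have := dist_triangle conG q (P i.+1) (P m); have := dist_adj qi1.
  clear -le2 im; lia.
split=> //.
- by move=> k ki; apply: path; apply: ltn_trans im.
- by split=> //; [apply: path|rewrite sedge_sym].
move=> x y xT yT.
have le : dist y (P m) <= m - i.
  move: yT; rewrite !inE => /or3P[]/eqP-> //; apply: leq_trans le2 _; clear; lia.
have := far x (P m) xT (mem_head _ _).
have := dist_triangle conG x y (P m); clear -le im; lia.
Qed.

(** By induction on the length of the path. If no interior vertex has degree 2,
    each has a third neighbour. A third neighbour of [P i] that is also adjacent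
    to [P i.-1] or [P i.+1] yields a triangle closer to one of the two given
    ones, and a part of the path would have an interior vertex of degree 2.
    Hence all third neighbours are rungs. *)
Lemma linked_degree2 m P a b c d : linked m P a b c d ->
  exists2 i, 0 < i < m & degree (P i) = 2.
Proof.
elim/ltn_ind: m P a b c d => m IH P a b c d L.
case: (L) => m0 path _ _ _.
have [/existsP[i /andP[i0 /eqP di]]|/existsPn no2] :=
  boolP [exists i : 'I_m, (0 < i) && (degree (P i) == 2)].
  by exists i; rewrite ?i0 //=.
have {}no2 i : 0 < i < m -> degree (P i) != 2.
  by case/andP=> i0 im; have := no2 (Ordinal im); rewrite /= i0.
exfalso.
have exq i : 0 < i < m -> exists q, rung m P i q.
  move=> im; have /andP[i0 i_m] := im.
  have ip : P i -- P i.-1.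
    by rewrite sedge_sym -[i in X in _ -- X](prednK i0); apply: path; clear -i0 i_m; lia.
  have is_ : P i -- P i.+1 by apply: path.
  have ne : P i.-1 != P i.+1.
    by have [] := linked_adj conG L (ltac:(clear -im; lia) : i.-1 < i.+1 <= m).
  have [q [qi qp qs]] := degree_ne2_adj ip is_ ne (no2 i im).
  exists q; apply: (rungI L im) => //; first by rewrite sedge_sym.
    apply/negP => qip.
    have [|k km dk] := IH (m - i) _ _ _ _ _ _ (linked_suffix L im qi qip).
      by clear -im; lia.
    by have := no2 (k + i); rewrite dk eqxx => /(_ ltac:(clear -km i0; lia)).
  apply/negP => qis.
  have [k km dk] := IH i i_m _ _ _ _ _ (linked_prefix L im qi qis).
  by have := no2 k; rewrite dk eqxx => /(_ ltac:(clear -km i_m; lia)).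
(* The boolean form is needed to choose a rung for each [i]. *)
pose rungb i q := [&& q -- P i, [forall j : 'I_m.+1, q != P j]
  & [forall j : 'I_m.+1, (q -- P j) ==> (val j == i)]].
have rungP i q : reflect (rung m P i q) (rungb i q).
  apply: (iffP and3P) => [[qi /forallP q1 /forallP q2]|[qi q1 q2]]; split=> //.
  - by move=> j jm; apply: (q1 (Ordinal (jm : j < m.+1))).
  - by move=> j jm qj; have := q2 (Ordinal (jm : j < m.+1)); rewrite /= qj => /eqP.
  - by apply/forallP => j; apply: q1; rewrite -ltnS.
  - by apply/forallP => j; apply/implyP => qj; apply/eqP; apply: q2 => //; rewrite -ltnS; exact: ltn_ord.
pose Q i := odflt (P 0) [pick q | rungb i q].
apply: (@no_rungs m P Q a b c d L) => i im; rewrite /Q; case: pickP => [q /rungP //|none].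
by have [q /rungP] := exq i im; rewrite none.
Qed.
End LinkedTrianglesCopy.

(** * Star colourings *)
Section StarColouring.
Variable G : sgraph.
Implicit Types (x y z w r : G) (A L : {set G}).

(** Colourings are total functions that are only constrained on [A], so that
    colourings of overlapping parts of a graph can be compared and merged. *)
Definition star_on (C : eqType) A (c : G -> C) : Prop :=
  (forall x y, x \in A -> y \in A -> x -- y -> c x != c y) /\
  (forall x y z w, all [in A] [:: x; y; z; w] -> uniq [:: x; y; z; w] ->
     x -- y -> y -- z -> z -- w -> c x = c z -> c y = c w -> False).

Lemma star_colouringP (C : finType) (c : {ffun G -> C}) :
  reflect (star_on setT c) (star_coloring c).
Proof.
apply: (iffP andP) => [[/forallP pr /forallP st]|[pr st]]; split.
- by move=> x y _ _ xy; have /forallP/(_ y)/implyP/(_ xy) := pr x.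
- move=> x y z w _ U xy yz zw cxz cyw.
  have /forallP/(_ y)/forallP/(_ z)/forallP/(_ w)/implyP := st x.
  rewrite U xy yz zw => /(_ isT); apply/negP; rewrite -leqNgt.
  apply: leq_trans (_ : #|[set c x; c y]| <= _); last by rewrite cards2; case: eqP.
  apply: subset_leq_card; apply/subsetP => i.
  by rewrite !inE -cxz -cyw => /orP[/orP[/orP[]|]|] ->; rewrite ?orbT.
- by apply/forallP => x; apply/forallP => y; apply/implyP => xy; apply: pr.
apply/forallP => x; apply/forallP => y; apply/forallP => z; apply/forallP => w.
apply/implyP => /and4P[U xy yz zw]; rewrite ltnNge; apply/negP => le.
have cxy : c x != c y by apply: pr.
(* At most two colours on the path: since [c x] and [c y] differ, they are all
   the colours, and properness makes the colours alternate. *)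
have E : [set c x; c y] = [set c x; c y; c z; c w].
  apply/eqP; rewrite eqEcard cards2 cxy le andbT; apply/subsetP => i.
  by rewrite !inE => /orP[]->; rewrite ?orbT.
have : c z \in [set c x; c y] by rewrite E !inE eqxx !orbT.
rewrite !inE eq_sym [c z == c y]eq_sym (negbTE (pr y z _ _ yz)) // orbF => /eqP xz.
have : c w \in [set c x; c y] by rewrite E !inE eqxx !orbT.
rewrite !inE xz eq_sym (negbTE (pr z w _ _ zw)) //= => /eqP yw.
by apply: (st x y z w) => //; apply/allP => u; rewrite inE.
Qed.

Lemma star_colorableP k :
  star_colorable G k <-> exists c : G -> 'I_k, star_on setT c.
Proof.
split=> [/existsP[c /star_colouringP]|[c [pr st]]]; first by exists c.
apply/existsP; exists (finfun c); apply/star_colouringP; split.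
  by move=> x y *; rewrite !ffunE; apply: pr.
by move=> x y z w ? ? ? ? ?; rewrite !ffunE; apply: st.
Qed.

(** It suffices that each edge has an end which is a leaf of the star formed by
    the two colours of the edge: the middle edge of a two-coloured path on four
    vertices violates this at both ends. *)
Lemma star_onI (C : eqType) A (c : G -> C) :
  (forall x y, x -- y -> c x != c y) ->
  (forall x y, x -- y -> (forall z, z -- x -> c z = c y -> z = y) \/
                         (forall z, z -- y -> c z = c x -> z = x)) ->
  star_on A c.
Proof.
move=> pr leaf; split=> [x y _ _|x y z w _ U xy yz zw xz yw]; first exact: pr.
move: U; rewrite /= !inE !negb_or => /and4P[/and3P[_ nxz _] /andP[_ nyw] _ _].
case: (leaf y z yz) => [/(_ x xy xz)/eqP|/(_ w)].
  by rewrite (negbTE nxz).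
by rewrite sedge_sym => /(_ zw (esym yw)) /eqP; rewrite eq_sym (negbTE nyw).
Qed.

(** Think of a tree with root [r] and depth function [depth], to which edges from
    [r] to some vertices of [L] at depth 2 have been added. In the tree, the
    child is the leaf of each edge when colours are depths modulo 3. An added
    edge has ends of depth 0 and 2; either its end in [L] is a leaf because it
    has no other neighbour of the colour of [r], or [r] is a leaf because [L]
    has only one element. *)
Lemma depth_star r L (depth : G -> nat) :
  depth r = 0 -> (forall l, l \in L -> depth l = 2) ->
  (forall x y, x -- y -> [\/ depth y = (depth x).+1, depth x = (depth y).+1,
     x = r /\ y \in L | y = r /\ x \in L]) ->
  (forall x y z, x -- y -> x -- z -> depth x = (depth y).+1 ->
     depth x = (depth z).+1 -> y = z) ->
  (forall l z, l \in L -> l -- z -> depth z %% 3 = 0 -> z = r) \/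
  (forall l l', l \in L -> l' \in L -> l = l') ->
  star_colorable G 3.
Proof.
move=> dr dL step parent short; apply/star_colorableP.
pose c x : 'I_3 := inord (depth x %% 3).
have cE x y : c x = c y -> depth x %% 3 = depth y %% 3.
  by move/(congr1 val); rewrite /= !inordK ?ltn_mod.
exists c; apply: star_onI.
  move=> x y xy; apply/eqP => /cE.
  case: (step x y xy) => [->|->|[->/dL->]|[->/dL->]]; rewrite ?dr //; lia.
have leaf x y : x -- y -> depth y = (depth x).+1 ->
    forall z, z -- y -> c z = c x -> z = x.
  move=> xy dy z zy /cE czx.
  case: (step z y zy) => [E|E|[zr /dL E]|[yr _]].
  - by apply: (parent y) => //; rewrite sedge_sym.
  - by move: czx; rewrite E dy; lia.
  - by move: czx; rewrite zr dr; move: E; rewrite dy => -[->].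
  - by move: dy; rewrite yr dr.
have leafr l : l \in L -> r -- l ->
   (forall z, z -- r -> c z = c l -> z = l) \/ (forall z, z -- l -> c z = c r -> z = r).
  move=> lL rl; case: short => [short|single]; [right|left].
    by move=> z zl /cE; rewrite dr mod0n; apply: short lL _; rewrite sedge_sym.
  move=> z zr /cE; rewrite (dL l) //; case: (step z r zr) => [|->|[zr' _]|[_ zL] _].
  - by rewrite dr.
  - by rewrite dr.
  - by move: zr; rewrite zr' sedge_irrefl.
  - exact: single.
move=> x y xy; case: (step x y xy) => [E|E|[E yL]|[E xL]].
- by right; apply: leaf.
- by left; apply: leaf; rewrite // sedge_sym.
- by rewrite E; apply: leafr; rewrite // -E.
- by rewrite E in xy *; have [|?|?] := leafr _ xL; [rewrite sedge_sym|right|left].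
Qed.

End StarColouring.

Section Induced.
Variables (G : sgraph) (A : {set G}).

Definition induced_rel : rel {x : G | x \in A} := fun x y => val x -- val y.

Lemma induced_rel_sym : symmetric induced_rel.
Proof. by move=> x y; apply: sedge_sym. Qed.

Lemma induced_rel_irrefl : irreflexive induced_rel.
Proof. by move=> x; apply: sedge_irrefl. Qed.

Definition induced : sgraph := SGraph induced_rel_sym induced_rel_irrefl.

Lemma induced_induced_copy H : induced_copy H induced -> induced_copy H G.
Proof.
case=> f finj fE; exists (fun x => val (f x)); first by move=> x y /val_inj/finj.
by move=> x y; rewrite -fE.
Qed.

Lemma chordal_induced : chordal G -> chordal induced.
Proof. by move=> chG n n4 /induced_induced_copy; apply: chG. Qed.

Lemma free_induced F : free_of F G -> free_of F induced.
Proof. by move=> frG H FH /induced_induced_copy; apply: frG. Qed.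

Lemma connected_induced :
  (forall x y, x \in A -> y \in A -> con A x y) -> connected_graph induced.
Proof.
move=> conA [x xA] [y yA]; have /connectP[p pP yE] := conA x y xA yA.
elim: p x xA pP yE => [|z p IH] x xA /=.
  by move=> _ E; rewrite (_ : exist _ x xA = exist _ y yA) ?connect0 //; apply: val_inj.
case/andP=> /andP[/andP[_ zA] xz] pP yE.
by apply: connect_trans (connect1 _) (IH z zA pP yE).
Qed.

Lemma star_induced : star_colorable induced 3 -> exists c : G -> 'I_3, star_on A c.
Proof.
case/star_colorableP => c [pr st].
exists (fun x => if insub x is Some u then c u else ord0); split.
  by move=> x y xA yA xy; rewrite !insubT; apply: pr.
move=> x y z w /= /and5P[xA yA zA wA _] U xy yz zw; rewrite !insubT.
move=> E1 E2; apply: (st (Sub x xA) (Sub y yA) (Sub z zA) (Sub w wA)) => //.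
by rewrite /= !inE.
Qed.

End Induced.

Lemma perm_two_points (C : finType) (a b a' b' : C) : a != b -> a' != b' ->
  exists s : {perm C}, s a = a' /\ s b = b'.
Proof.
move=> ab ab'; exists (tperm a a' * tperm (tperm a a' b) b')%g.
rewrite !permM tpermL tpermL; split=> //; apply: tpermD; last by rewrite eq_sym.
by rewrite -[X in _ != X](tpermL a) (inj_eq perm_inj) eq_sym.
Qed.

Section Glue.
Variable G : sgraph.
Implicit Types (x y z w u : G) (A B : {set G}).

(** At the cut vertex [z] the colours of the second side are permuted so that [z]
    agrees and its two neighbours [u] and [v] get different colours. A path
    that changes sides passes through [u, z, v] and hence sees three colours. *)
Lemma star_glue A B z u v : (forall x, x \in A \/ x \in B) ->
  (forall x, x \in A -> x \in B -> x = z) -> z \in A -> z \in B ->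
  u \in A -> v \in B -> z -- u -> z -- v ->
  (forall x y, x -- y -> (x \in A) && (y \in A) \/ (x \in B) && (y \in B)) ->
  (forall x, z -- x -> x = u \/ x = v) ->
  (exists c : G -> 'I_3, star_on A c) -> (exists c : G -> 'I_3, star_on B c) ->
  star_colorable G 3.
Proof.
move=> cover cap zA zB uA vB zu zv side only [c1 [pr1 st1]] [c2 [pr2 st2]].
have [t tz tu] : exists2 t : 'I_3, c1 z != t & c1 u != t.
  have : exists t : 'I_3, t \notin [set c1 z; c1 u].
    apply/existsP; rewrite -negb_forall; apply/negP => /forallP all_in.
    have : #|'I_3| <= #|[set c1 z; c1 u]|.
      by apply: subset_leq_card; apply/subsetP => i _; apply: all_in.
    by rewrite card_ord cards2; case: eqP.
  by case=> t; rewrite !inE negb_or => /andP[? ?]; exists t; rewrite eq_sym.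
have [s [sz sv]] := perm_two_points (pr2 z v zB vB zv) tz.
pose c x := if x \in A then c1 x else s (c2 x).
have cA x : x \in A -> c x = c1 x by rewrite /c => ->.
have cB x : x \in B -> c x = s (c2 x).
  by rewrite /c; case: ifP => // xA xB; rewrite (cap x) ?sz.
(* A neighbour of [z] in [A] must be [u] and one in [B] must be [v]. *)
have nu x y : z -- x -> z -- y -> x \in A -> y \in B -> c x != c y.
  move=> zx zy xA yB; have neq w : z -- w -> w \in A -> w \in B -> False.
    by move=> zw wA wB; move: zw; rewrite (cap w) ?sedge_irrefl.
  have -> : x = u.
    by case: (only x zx) => // E; case: (neq x zx xA); rewrite E.
  have -> : y = v.
    by case: (only y zy) => // E; case: (neq y zy _ yB); rewrite E.
  by rewrite cA // cB // sv.
apply/star_colorableP; exists c; split.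
  move=> x y _ _ xy; case: (side x y xy) => /andP[xS yS].
    by rewrite !cA //; apply: pr1.
  by rewrite !cB // (inj_eq perm_inj); apply: pr2.
move=> x y t' w _ U xy yt tw cxt cyw.
have bad p q m : p -- m -> m -- q -> p \in A -> m \in A -> m \in B -> q \in B ->
    c p != c q.
  by move=> pm mq pA mA mB; apply: nu => //; rewrite -(cap m) // sedge_sym.
case: (side x y xy) => /andP[xS yS]; case: (side y t' yt) => /andP[yS' tS];
  case: (side t' w tw) => /andP[tS' wS].
- by apply: (st1 x y t' w) => //; rewrite /= -?cA ?xS ?yS ?tS ?wS.
- by have := bad y w t' yt tw yS' tS tS' wS; rewrite cyw eqxx.
- by have := bad x t' y xy yt xS yS yS' tS; rewrite cxt eqxx.
- by have := bad x t' y xy yt xS yS yS' tS; rewrite cxt eqxx.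
- by have := bad t' x y; rewrite sedge_sym [y -- x]sedge_sym cxt eqxx => /(_ yt xy tS yS' yS xS).
- by have := bad t' x y; rewrite sedge_sym [y -- x]sedge_sym cxt eqxx => /(_ yt xy tS yS' yS xS).
- by have := bad w y t'; rewrite sedge_sym [t' -- y]sedge_sym cyw eqxx => /(_ tw yt wS tS' tS yS').
- apply: (st2 x y t' w) => //; first by rewrite /= xS yS tS wS.
    by apply: (@perm_inj _ s); rewrite -!cB.
  by apply: (@perm_inj _ s); rewrite -!cB.
Qed.
End Glue.

(** * Distance layers in chordal graphs *)
Section Layers.
Variable G : sgraph.
Hypotheses (conG : connected_graph G) (chG : chordal G).
Implicit Types (a b l r s t u v w x y z : G).

Definition triangle x y z : bool := [&& x -- y, x -- z & y -- z].

Lemma triangleP x y z : reflect [/\ x -- y, x -- z & y -- z] (triangle x y z).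
Proof. exact: and3P. Qed.

Lemma layer_dist r x y : x -- y ->
  [\/ dist r x = dist r y, dist r y = (dist r x).+1 | dist r x = (dist r y).+1].
Proof.
move=> xy; have := dist_step conG r xy; rewrite sedge_sym in xy.
have := dist_step conG r xy; case: (ltngtP (dist r x) (dist r y)) => le le1 le2.
- by apply: Or32; apply/eqP; rewrite eqn_leq le le2.
- by apply: Or33; apply/eqP; rewrite eqn_leq le le1.
- by apply: Or31.
Qed.

Lemma layer0 r x : dist r x = 0 -> x = r.
Proof. by move/(dist_eq0 conG). Qed.

Lemma ball_con r x n : dist r x < n -> con [set y | dist r y < n] x r.
Proof.
move dE: (dist r x) => d; elim: d x dE => [|d IH] x dE dn.
  by rewrite (layer0 dE) con0.
have xr : x != r by apply: contra_eqN dE => /eqP->; rewrite dist0.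
have [y yx E] := dist_pred conG xr.
have [dy] : d.+1 = (dist r y).+1 by rewrite -E.
apply: con_trans (IH y (esym dy) (ltnW dn)); apply: con1; rewrite ?inE ?dE -?dy //; first exact: ltnW.
by rewrite sedge_sym.
Qed.

Lemma ball_con2 r x y n : dist r x < n -> dist r y < n ->
  con [set z | dist r z < n] x y.
Proof.
by move=> xn yn; apply: con_trans (ball_con xn) _; rewrite con_sym ball_con.
Qed.

(** Both ends have neighbours in the ball of smaller radius around [r], which is
    connected. *)
Lemma same_layer r x y : x -- y -> dist r x = dist r y ->
  exists2 z, triangle x y z & dist r z < dist r x.
Proof.
move=> xy dE.
have xr : x != r.
  apply: contraTneq xy => xr; have -> : y = r by apply: layer0; rewrite -dE xr dist0.
  by rewrite xr sedge_irrefl.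
have yr : y != r by apply: contraNneq xr => yr; rewrite (@layer0 r x) // dE yr dist0.
have [x' xx' dx'] := dist_pred conG xr; have [y' yy' dy'] := dist_pred conG yr.
rewrite sedge_sym in xx'; rewrite sedge_sym in yy'.
have [x'lt y'lt] : dist r x' < dist r x /\ dist r y' < dist r x.
  by rewrite [in X in _ /\ X]dE dx' dy'.
have [|||z [zB _ xz yz]] := chordal_common_nbr chG xy _ _ _ (ball_con2 x'lt y'lt) xx' yy'.
- by rewrite inE ltnn.
- by rewrite inE dE ltnn.
- by rewrite inE.
by exists z; [apply/triangleP|rewrite inE in zB].
Qed.

(** [x] and [y] are joined through the ball around [r] that lies below their
    layer, and [w] has no neighbour there. *)
Lemma two_parents r w x y : w -- x -> w -- y -> x != y ->
  dist r w = (dist r x).+1 -> dist r w = (dist r y).+1 -> triangle w x y.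
Proof.
move=> wx wy xy dx dy; apply/triangleP; split=> //.
have dxy : dist r x = dist r y by move: dx; rewrite dy => -[].
apply: (chordal_detour chG (A := [set x; y] :|: [set z | dist r z < dist r x]) wx) => //.
- rewrite !inE !negb_or !adj_neq //= dx; lia.
- have xr : x != r.
    by apply: contraNneq xy => xr; rewrite xr (@layer0 r y) // -dxy xr dist0.
  have yr : y != r by apply: contraNneq xr => yr; rewrite (@layer0 r x) // dxy yr dist0.
  have [x' xx' dx'] := dist_pred conG xr; have [y' yy' dy'] := dist_pred conG yr.
  apply: (@con_trans _ _ x').
    by apply: con1; rewrite ?inE ?eqxx ?dx' ?leqnn ?orbT // sedge_sym.
  apply: (@con_trans _ _ y').
    apply: con_sub (subsetUr _ _) _; apply: ball_con2; lia.
  by apply: con1; rewrite ?inE ?eqxx ?dxy ?dy' ?leqnn ?orbT.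
- move=> z; rewrite !inE => /orP[/orP[]/eqP->|dz] wz; [by left|by right|].
  by have := dist_step conG r (_ : z -- w); rewrite sedge_sym => /(_ wz); lia.
Qed.

End Layers.

(** * Colouring when all triangles share a vertex or there is only one *)
Section OneHub.
Variable G : sgraph.
Hypotheses (conG : connected_graph G) (chG : chordal G).
Implicit Types (a b l r s t u v w x y z : G).

Lemma dist_adj_eq x y : x -- y -> dist x y = 1.
Proof.
move=> xy; apply/eqP; rewrite eqn_leq dist_adj //= lt0n.
by apply: contraTneq xy => /(dist_eq0 conG)->; rewrite sedge_irrefl.
Qed.

(** Each triangle consists of [r] and an edge inside the first layer; one end of
    that edge, of degree 2, is chosen into [L] and hung below the other end
    instead of below [r]. What remains after deleting the edges from [r] to [L]
    is a tree: two vertices of a layer that are adjacent or have a common child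
    lie in a triangle, and every triangle contains [r]. *)
Lemma star_windmill r :
  (forall x y z, triangle x y z -> r \in [:: x; y; z]) ->
  (forall a b, triangle r a b -> degree a = 2 \/ degree b = 2) ->
  star_colorable G 3.
Proof.
move=> hub tip.
(* When both ends have degree 2, the enumeration of the vertices decides. *)
pose L := [set x | [&& r -- x, degree x == 2 & [exists y, [&& r -- y, x -- y &
  (degree y != 2) || (enum_rank y < enum_rank x)]]]].
pose depth x := if x \in L then 2 else dist r x.
have LP x : x \in L -> r -- x by rewrite inE => /and3P[].
have rL : r \notin L by apply: contraTN isT => /LP; rewrite sedge_irrefl.
have onlyL x y z : triangle r x y -> x \in L -> x -- z -> z = r \/ z = y.
  case/triangleP=> rx ry xy; rewrite inE => /and3P[_ /eqP dx _] xz.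
  by apply: (degree2_adj dx _ xy) => //; adj.
have triL x : x \in L -> exists y, triangle r x y.
  by rewrite inE => /and3P[rx _ /existsP[y /and3P[ry xy _]]]; exists y; apply/triangleP.
have excl x y : triangle r x y -> x \in L -> y \notin L.
  move=> T xL; have [rx ry xy] := triangleP _ _ _ T.
  have T' : triangle r y x by apply/triangleP; rewrite (sedge_sym y).
  apply/negP => yL.
  move: (xL); rewrite inE => /and3P[_ dx /existsP[y' /and3P[ry' xy' c1]]].
  move: (yL); rewrite inE => /and3P[_ dy /existsP[x' /and3P[rx' yx' c2]]].
  have {}y'E : y' = y.
    by case: (onlyL _ _ _ T xL xy') => // E; rewrite E sedge_irrefl in ry'.
  have {}x'E : x' = x.
    by case: (onlyL _ _ _ T' yL yx') => // E; rewrite E sedge_irrefl in rx'.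
  by move: c1 c2; rewrite y'E x'E dx dy /= => /ltn_trans lt /lt; rewrite ltnn.
have one x y : triangle r x y -> x \notin L -> y \in L.
  move=> T xL; have [rx ry xy] := triangleP _ _ _ T.
  have [/eqP dy|dy] := boolP (degree y == 2); last first.
    have dx : degree x = 2 by case: (tip _ _ T) => // E; rewrite E eqxx in dy.
    by case/negP: xL; rewrite inE rx dx eqxx /=; apply/existsP; exists y; rewrite ry xy dy.
  rewrite inE ry dy eqxx /=; apply/existsP; exists x; rewrite rx sedge_sym xy /=.
  have [/eqP dx|//] := boolP (degree x == 2); rewrite /= ltnNge; apply: contra xL => le.
  rewrite inE rx dx eqxx /=; apply/existsP; exists y; rewrite ry xy /=; apply/orP; right.
  rewrite ltn_neqAle le andbT; apply: contraTneq xy => /val_inj/enum_rank_inj->.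
  by rewrite sedge_irrefl.
have dL x : x \in L -> dist r x = 1 by move/LP/dist_adj_eq.
have flat x y : x -- y -> dist r x = dist r y -> triangle r x y.
  move=> xy dE; have [z T lt] := same_layer conG chG xy dE.
  have := hub _ _ _ T; rewrite !inE.
  have xr : r != x by apply: contraTneq lt => <-; rewrite dist0.
  have yr : r != y by apply: contraTneq lt => E; rewrite dE -E dist0.
  rewrite (negbTE xr) (negbTE yr) /= => /eqP->.
  by case/triangleP: T => ? ? ?; apply/triangleP; split=> //; rewrite sedge_sym.
have up x y : x -- y -> dist r y = (dist r x).+1 -> x \notin L /\ (y \in L -> x = r).
  move=> xy dy; split.
    apply/negP => xL; have [p T] := triL x xL.
    move: dy; rewrite (dL x xL); case: (onlyL _ _ _ T xL xy) => ->; rewrite ?dist0 //.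
    by case/triangleP: T => _ /dist_adj_eq->.
  by move=> yL; apply: layer0 => //; move: dy; rewrite (dL y yL) => -[].
have upE x y : x -- y -> dist r y = (dist r x).+1 ->
    depth y = (depth x).+1 \/ x = r /\ y \in L.
  move=> xy dy; have [xL yL] := up x y xy dy; rewrite /depth (negbTE xL).
  by case: ifP => [yL'|_]; [right; split=> //; apply: yL|left].
apply: (depth_star (r := r) (L := L) (depth := depth)).
- by rewrite /depth (negbTE rL) dist0.
- by move=> l; rewrite /depth => ->.
- move=> x y xy; case: (layer_dist conG r xy) => dE.
  + have T := flat x y xy dE; have [rx ry _] := triangleP _ _ _ T.
    rewrite /depth; have [xL|xL] := boolP (x \in L).
      by rewrite (negbTE (excl _ _ T xL)) dist_adj_eq //; apply: Or42.
    by rewrite (one _ _ T xL) dist_adj_eq //; apply: Or41.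
  + by case: (upE _ _ xy dE) => [|[]]; [apply: Or41|move=> *; apply: Or43].
  + rewrite sedge_sym in xy.
    by case: (upE _ _ xy dE) => [|[]]; [apply: Or42|move=> *; apply: Or44].
- move=> x y z xy xz.
  have [xL|xL] := boolP (x \in L).
    have [p T] := triL x xL; rewrite {1 3}/depth xL => -[Ey] -[Ez].
    have only u : x -- u -> 1 = depth u -> u = p.
      move=> xu; case: (onlyL _ _ _ T xL xu) => // ->.
      by rewrite /depth (negbTE rL) dist0.
    by rewrite (only y) // (only z).
  rewrite {1 3}/depth (negbTE xL).
  have par u : x -- u -> dist r x = (depth u).+1 -> dist r x = (dist r u).+1.
    move=> xu; rewrite /depth; case: ifP => // uL E.
    by have := dist_step conG r (_ : u -- x); rewrite E (dL u uL) sedge_sym => /(_ xu).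
  move=> /(par y xy) dy /(par z xz) dz; apply/eqP; apply: contraT => yz; exfalso.
  have T := two_parents conG chG xy xz yz dy dz.
  have yr : r != y.
    apply: contraNneq yz => E; apply/eqP; rewrite -E [RHS](@layer0 _ conG r z) //.
    by move: dz; rewrite dy -E dist0 => -[].
  have zr : r != z.
    apply: contraNneq yz => E; apply/eqP; rewrite -E [LHS](@layer0 _ conG r y) //.
    by move: dy; rewrite dz -E dist0 => -[].
  have xr : r != x by apply: contraPneq dy => <-; rewrite dist0.
  by have := hub _ _ _ T; rewrite !inE (negbTE xr) (negbTE yr) (negbTE zr).
- left=> l z lL lz dz; have [p T] := triL l lL.
  case: (onlyL _ _ _ T lL lz) => // E; move: dz; rewrite E /depth (negbTE (excl _ _ T lL)).
  by case/triangleP: T => _ /dist_adj_eq->.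
Qed.

(** Deleting the edge from [a] to [l] leaves a tree. Its depth function from [a]
    differs from the distance in [G] only on the branch of [l], whose vertices
    are those closer to [l] than to [a] and lie one step deeper. *)
Lemma star_unicyclic a b l : triangle a b l ->
  (forall x y z, triangle x y z -> all [in [:: a; b; l]] [:: x; y; z]) ->
  star_colorable G 3.
Proof.
case/triangleP=> ab al bl only.
pose branch x := dist l x < dist a x.
pose depth x := dist a x + branch x.
have la : dist l a = 1 by rewrite dist_adj_eq // sedge_sym.
have lb : dist l b = 1 by rewrite dist_adj_eq // sedge_sym.
have [a1 a2] : dist a b = 1 /\ dist a l = 1 by rewrite !dist_adj_eq.
have da : depth a = 0 by rewrite /depth /branch dist0.
have db : depth b = 1 by rewrite /depth /branch a1 lb.
have dl : depth l = 2 by rewrite /depth /branch a2 dist0.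
have leq_al x : dist a x <= (dist l x).+1.
  by have := dist_triangle conG a l x; rewrite a2 add1n.
have corner x : x \in [:: a; b; l] -> dist a x <= 1.
  by rewrite !inE => /or3P[]/eqP->; rewrite ?dist0 ?a1 ?a2.
have cornerN x : x \in [:: a; b; l] -> 0 < dist a x -> x = b \/ x = l.
  by rewrite !inE => /or3P[]/eqP->; rewrite ?dist0 //; [left|right].
have flat x y : x -- y -> dist a x = dist a y -> (x = b /\ y = l) \/ (x = l /\ y = b).
  move=> xy dE; have [z T lt] := same_layer conG chG xy dE.
  have /and4P[xT yT _ _] := only _ _ _ T.
  have x0 : 0 < dist a x by apply: leq_ltn_trans lt.
  have y0 : 0 < dist a y by rewrite -dE.
  case: (cornerN x xT x0) (cornerN y yT y0) xy => -> [] ->; rewrite ?sedge_irrefl //; by [left|right].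
have uniq_par x y z : x -- y -> x -- z -> dist a x = (dist a y).+1 ->
    dist a x = (dist a z).+1 -> y = z.
  move=> xy xz dy dz; apply/eqP; apply: contraT => yz; exfalso.
  have T := two_parents conG chG xy xz yz dy dz.
  have /and4P[xT yT zT _] := only _ _ _ T.
  have := corner x xT; rewrite dy ltnS leqn0 => /eqP y0.
  have z0 : dist a z = 0 by move: dz; rewrite dy y0 => -[].
  by rewrite (layer0 conG y0) (layer0 conG z0) eqxx in yz.
have up x y : x -- y -> dist a y = (dist a x).+1 ->
    branch y = branch x \/ x = a /\ y = l.
  move=> xy dy; rewrite /branch.
  have [bx|bx] := boolP (dist l x < dist a x).
    by left; rewrite dy; apply/idP; rewrite ltnS (leq_trans (dist_step conG l xy)).
  have [by_|//] := ltnP (dist l y) (dist a y); last by left.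
  have [yl|yl] := eqVneq y l.
    right; split=> //; apply: layer0 => //.
    by move: dy; rewrite yl a2 => -[].
  exfalso; have [x' x'y dx'] := dist_pred conG yl.
  case: (layer_dist conG a x'y) => dE.
  - case: (flat _ _ x'y dE) => -[E1 E2]; first by rewrite E2 eqxx in yl.
    by move: by_; rewrite E2 lb a1.
  - have E : x = x' by apply: (uniq_par y); rewrite // sedge_sym.
    by move: bx by_; rewrite E dE dx' ltnS => /negbTE->.
  - by have := leq_al x'; rewrite dE; lia.
apply: (depth_star (r := a) (L := [set l]) (depth := depth)) => //.
- by move=> x; rewrite inE => /eqP->.
- move=> x y xy; case: (layer_dist conG a xy) => dE.
  + case: (flat _ _ xy dE) => -[-> ->]; rewrite db dl; [exact: Or41|exact: Or42].
  + case: (up _ _ xy dE) => [E|[-> ->]]; last by apply: Or43; rewrite inE.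
    by apply: Or41; rewrite /depth dE E.
  + rewrite sedge_sym in xy; case: (up _ _ xy dE) => [E|[-> ->]]; last by apply: Or44; rewrite inE.
    by apply: Or42; rewrite /depth dE E.
- have par x y : x -- y -> depth x = (depth y).+1 ->
      x = l /\ y = b \/ x <> l /\ dist a x = (dist a y).+1.
    move=> xy; case: (layer_dist conG a xy) => dE.
    + by case: (flat _ _ xy dE) => -[-> ->]; [rewrite db dl|left].
    + by case: (up _ _ xy dE) => [E|[-> ->]]; rewrite ?da ?dl //; rewrite /depth dE E; lia.
    + rewrite sedge_sym in xy; case: (up _ _ xy dE) => [E|[-> ->]]; rewrite ?da ?dl //.
      move=> _; right; split=> // xl; move: dE; rewrite xl a2 => -[/esym/(layer0 conG) ya].
      by move: E; rewrite xl ya /branch !dist0 a2 la.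
  move=> x y z xy xz /(par _ _ xy)[[xl ->]|[nl dy]] /(par _ _ xz)[[xl' ->]|[nl' dz]] //.
  by apply: uniq_par xy xz dy dz.
- by right=> x y; rewrite !inE => /eqP-> /eqP->.
Qed.

End OneHub.

(** * Star colourings of free chordal graphs *)
Section Triangles.
Variable G : sgraph.
Implicit Types (a b l r s t u v w x y z : G) (A B : {set G}) (p : seq G).

Lemma triangle_uniq x y z : triangle x y z -> uniq [:: x; y; z].
Proof. by case/triangleP=> *; rewrite /= !inE negb_or !adj_neq. Qed.

Lemma triangle_pick x y z v : triangle x y z -> v \in [:: x; y; z] ->
  exists u w, triangle v u w /\ [:: v; u; w] =i [:: x; y; z].
Proof.
case/triangleP=> xy xz yz; rewrite !inE => /or3P[]/eqP->.
- by exists y, z; split=> //; apply/triangleP.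
- exists x, z; split; first by apply/triangleP; rewrite (sedge_sym y).
  by move=> u; rewrite !inE orbCA.
- exists x, y; split; first by apply/triangleP; rewrite !(sedge_sym z).
  by move=> u; rewrite !inE orbCA orbA orbC; do 3 case: (_ == _).
Qed.

Lemma triangle_same x y z a b c : triangle x y z ->
  {subset [:: x; y; z] <= [:: a; b; c]} -> [:: x; y; z] =i [:: a; b; c].
Proof. by move=> /triangle_uniq U sub; have [] := uniq_min_size U sub. Qed.

Hypothesis conG : connected_graph G.

Lemma joining_linked A B x p a b c d : joining_path A B x p -> 0 < set_dist A B ->
  a \in A -> b \in A -> triangle x a b -> c \in B -> d \in B -> triangle (last x p) c d ->
  linked (size p) (nth x (x :: p)) a b c d.
Proof.
case=> xA lB pP ps AB aA bA /triangleP[xa xb ab] cB dB /triangleP[lc ld cd].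
have lE : nth x (x :: p) (size p) = last x p by rewrite -[size p]/(size (x :: p)).-1 nth_last.
split; rewrite ?lE //; first by rewrite ps.
  by move=> i ip; move/(pathP x): pP; apply.
move=> y z yT zT; rewrite ps; apply: set_dist_le_dist => //.
  by move: yT; rewrite !inE => /or3P[]/eqP->.
by move: zT; rewrite !inE => /or3P[]/eqP->.
Qed.

Hypotheses (chG : chordal G) (frG : free_of F3ch G).

(** If there is a diamond with base [s], [t], every triangle through an apex
    contains both [s] and [t], so each triangle contains one of them; two
    triangles that each miss one would meet in an apex, which is impossible.
    Without diamonds, two triangles share exactly one vertex [r], and a triangle
    avoiding [r] but meeting both would create a diamond. The corners of
    degree 2 then come from comparing a triangle with a different one. *)
Lemma windmill_hub a b l a' b' l' :
  (forall x y z x' y' z', triangle x y z -> triangle x' y' z' ->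
     exists2 v, v \in [:: x; y; z] & v \in [:: x'; y'; z']) ->
  triangle a b l -> triangle a' b' l' -> ~~ all [in [:: a; b; l]] [:: a'; b'; l'] ->
  exists2 r, forall x y z, triangle x y z -> r \in [:: x; y; z]
    & forall a b, triangle r a b -> degree a = 2 \/ degree b = 2.
Proof.
move=> meet T1 T2 T12.
suff [r hub] : exists r, forall x y z, triangle x y z -> r \in [:: x; y; z].
  exists r => // u v T.
  (* One of the two given triangles has a corner outside [r, u, v]. *)
  have [c [d [T' cN]]] : exists c d, triangle r c d /\ c \notin [:: u; v].
    have other x y z : triangle x y z -> ~~ all [in [:: r; u; v]] [:: x; y; z] ->
        exists c d, triangle r c d /\ c \notin [:: u; v].
      move=> Tx; have [c [d [T' E]]] := triangle_pick Tx (hub _ _ _ Tx).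
      rewrite -(eq_all_r E) /= inE eqxx /= andbT negb_and => /orP[cN|dN].
        by exists c, d; split=> //; apply: contra cN => cuv; rewrite inE cuv orbT.
      exists d, c; split; last by apply: contra dN => duv; rewrite inE duv orbT.
      by case/triangleP: T' => *; apply/triangleP; rewrite (sedge_sym d).
    have [sub1|/other] := boolP (all [in [:: r; u; v]] [:: a; b; l]); last by apply.
    apply: (other _ _ _ T2); apply: contra T12 => sub2.
    by apply/allP => x /(allP sub2); rewrite (triangle_same T1 (allP sub1)).
  have [ru rv uv] := triangleP _ _ _ T; have [rc rd cd] := triangleP _ _ _ T'.
  move: cN; rewrite !inE negb_or => /andP[cu cv].
  have [du|du] := eqVneq d u.
    right; rewrite du in cd rd; apply: (@diamond_degree2 _ chG frG r u c v); adj.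
  have [dv|dv] := eqVneq d v.
    left; rewrite dv in cd rd; apply: (@diamond_degree2 _ chG frG r v c u); adj.
  by apply: (two_triangles_degree2 chG frG ru rv uv rc rd cd); rewrite eq_sym.
have [/existsP[s /existsP[t /existsP[m /existsP[n /and3P[D1 D2 nmn]]]]]|noD] :=
  boolP [exists s : G, exists t : G, exists m : G, exists n : G,
    [&& triangle s t m, triangle s t n & m != n]].
  have [st sm tm] := triangleP _ _ _ D1; have [_ sn tn] := triangleP _ _ _ D2.
  have apex x y z v : v = m \/ v = n -> triangle x y z -> v \in [:: x; y; z] ->
      (s \in [:: x; y; z]) && (t \in [:: x; y; z]).
    move=> vmn T vT; have [u [w [/triangleP[vu vw uw] E]]] := triangle_pick T vT.
    have only k : v -- k -> k = s \/ k = t.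
      case: vmn => ->; [apply: (@diamond_adj _ chG frG s t n m)|apply: (@diamond_adj _ chG frG s t m n)]; adj.
    rewrite -!E !inE; case: (only u vu) (only w vw) uw => -> [] ->;
      by rewrite ?sedge_irrefl // !eqxx ?orbT.
  have [/existsP[x /existsP[y /existsP[z /andP[T sN]]]]|noS] :=
    boolP [exists x, exists y, exists z, triangle x y z && (s \notin [:: x; y; z])]; last first.
    exists s => x y z T; apply: contraNT noS => sN.
    by apply/existsP; exists x; apply/existsP; exists y; apply/existsP; exists z; rewrite T.
  exists t => x' y' z' T'; apply: contraT => tN; exfalso.
  have has_st x0 y0 z0 : triangle x0 y0 z0 -> (s \in [:: x0; y0; z0]) || (t \in [:: x0; y0; z0]).
    move=> T0; have [v vT] := meet _ _ _ _ _ _ T0 D1.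
    rewrite [v \in _]inE [v \in _]inE [v \in _]inE => /or3P[]/eqP vE.
    - by rewrite -vE vT.
    - by rewrite -[t]vE vT orbT.
    - by have /andP[-> _] := apex _ _ _ v (or_introl vE) T0 vT.
  have tT : t \in [:: x; y; z] by have := has_st _ _ _ T; rewrite (negbTE sN).
  have sT' : s \in [:: x'; y'; z'] by have := has_st _ _ _ T'; rewrite (negbTE tN) orbF.
  have [v vT vT'] := meet _ _ _ _ _ _ T T'.
  have adjT x0 y0 z0 u0 v0 : triangle x0 y0 z0 -> u0 \in [:: x0; y0; z0] ->
      v0 \in [:: x0; y0; z0] -> u0 != v0 -> u0 -- v0.
    move=> T0 uT vT0 nuv; have [u1 [w1 [/triangleP[e1 e2 _] E]]] := triangle_pick T0 uT.
    by move: vT0; rewrite -E !inE => /or3P[]/eqP Ev; rewrite Ev // ?eqxx // in nuv *.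
  have vs : v != s by apply: contraNneq sN => <-.
  have vt : v != t by apply: contraNneq tN => <-.
  have vs' : v -- s := adjT _ _ _ _ _ T' vT' sT' vs.
  have vt' : v -- t := adjT _ _ _ _ _ T vT tT vt.
  have [u [w [/triangleP[vu vw uw] E]]] := triangle_pick T vT.
  have only k : v -- k -> k = s \/ k = t.
    have [vm|vm] := eqVneq v m.
      by rewrite vm; apply: (@diamond_adj _ chG frG s t n m); adj.
    by apply: (@diamond_adj _ chG frG s t m v); adj.
  case/negP: sN; rewrite -E !inE; case: (only u vu) (only w vw) uw => -> [] ->;
    by rewrite ?sedge_irrefl // !eqxx ?orbT.
have {}noD s t m n : triangle s t m -> triangle s t n -> m = n.
  move=> D1 D2; apply/eqP; apply: contraNT noD => nmn.
  apply/existsP; exists s; apply/existsP; exists t; apply/existsP; exists m; apply/existsP; exists n.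
  by rewrite D1 D2 nmn.
have [r rT1 rT2] := meet _ _ _ _ _ _ T1 T2.
have [u [v [Tu Eu]]] := triangle_pick T1 rT1; have [w [k [Tw Ew]]] := triangle_pick T2 rT2.
have [ru rv uv] := triangleP _ _ _ Tu; have [rw rk wk] := triangleP _ _ _ Tw.
have Tv : triangle r v u by apply/triangleP; rewrite (sedge_sym v).
have Tk : triangle r k w by apply/triangleP; rewrite (sedge_sym k).
have apart : ~~ ((w \in [:: u; v]) || (k \in [:: u; v])).
  apply: contra T12 => wk_uv; rewrite -(eq_all_r Ew).
  have -> : all [in [:: a; b; l]] [:: r; w; k] = all [in [:: r; u; v]] [:: r; w; k].
    by apply: eq_all => x; rewrite Eu.
  have step x y : triangle r x y -> x \in [:: u; v] -> y \in [:: u; v].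
    move=> Txy; rewrite [x \in _]inE [x \in _]inE => /orP[]/eqP E; rewrite E in Txy.
      by rewrite (noD _ _ _ _ Txy Tu) !inE eqxx orbT.
    by rewrite (noD _ _ _ _ Txy Tv) !inE eqxx.
  have [wuv kuv] : w \in [:: u; v] /\ k \in [:: u; v].
    by case/orP: wk_uv => uvP; split=> //; apply: step uvP.
  apply/and4P; split=> //; first exact: mem_head.
    by apply: mem_behead.
  by apply: mem_behead.
exists r => x y z T; apply: contraT => rN; exfalso.
have [e eT eu] := meet _ _ _ _ _ _ T Tu; have [g gT gw] := meet _ _ _ _ _ _ T Tw.
have er : e != r by apply: contraNneq rN => <-.
have gr : g != r by apply: contraNneq rN => <-.
move: eu gw; rewrite !inE (negbTE er) (negbTE gr) /= => eu gw.
move: apart; rewrite !inE !negb_or => /andP[/andP[wu wv] /andP[ku kv]].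
have eg : e -- g.
  have [u1 [w1 [/triangleP[e1 e2 _] E]]] := triangle_pick T eT.
  move: gT; rewrite -E !inE => /or3P[]/eqP Eg; rewrite ?Eg //.
  move: eu gw; rewrite Eg => /orP[]/eqP-> /orP[]/eqP Ee; move: wu wv ku kv; by rewrite Ee eqxx.
have no e' g' : triangle r e e' -> triangle r g g' -> e' != g -> False.
  move=> Te Tg; have Teg : triangle r e g.
    by case/triangleP: Te => re _ _; case/triangleP: Tg => rg _ _; apply/triangleP.
  by rewrite (noD _ _ _ _ Te Teg) eqxx.
by case/orP: eu gw => /eqP Ee /orP[]/eqP Eg;
  [apply: (no v k)|apply: (no v w)|apply: (no u k)|apply: (no u w)];
  rewrite ?Ee ?Eg // eq_sym.
Qed.

(** A shortest path between two disjoint triangles would have an interior vertex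
    of degree 2, whose neighbours on the path are not adjacent. So any two
    triangles meet. *)
Lemma star_reduced :
  (forall z u v, degree z = 2 -> z -- u -> z -- v -> u != v -> u -- v) ->
  star_colorable G 3.
Proof.
move=> red.
have meet x y z x' y' z' : triangle x y z -> triangle x' y' z' ->
     exists2 v, v \in [:: x; y; z] & v \in [:: x'; y'; z'].
  move=> T T'; pose A := [set v in [:: x; y; z]]; pose B := [set v in [:: x'; y'; z']].
  have xA : x \in A by rewrite !inE eqxx.
  have xB : x' \in B by rewrite !inE eqxx.
  have [s [p J]] := joining_path_exists conG xA xB; have [sA lB pP ps] := J.
  have [E|AB] := posnP (set_dist A B).
    move: ps lB sA; rewrite E; case: (p) => //= _ sB sA; exists s; move: sA sB; by rewrite !inE.
  exfalso; have sT : s \in [:: x; y; z] by rewrite inE in sA.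
  have lT : last s p \in [:: x'; y'; z'] by rewrite inE in lB.
  have [a [b [Ta Ea]]] := triangle_pick T sT; have [c [d [Tc Ec]]] := triangle_pick T' lT.
  have L : linked (size p) (nth s (s :: p)) a b c d.
    apply: (joining_linked J) => //; rewrite inE.
    - by rewrite -Ea !inE eqxx orbT.
    - by rewrite -Ea !inE eqxx !orbT.
    - by rewrite -Ec !inE eqxx orbT.
    - by rewrite -Ec !inE eqxx !orbT.
  have [i /andP[i0 im] di] := linked_degree2 conG chG frG L.
  have [ne ad] := linked_adj conG L (ltac:(clear -i0 im; lia) : i.-1 < i.+1 <= size p).
  have [_ ad1] := linked_adj conG L (ltac:(clear -i0 im; lia) : i.-1 < i <= size p).
  have [_ ad2] := linked_adj conG L (ltac:(clear -i0 im; lia) : i < i.+1 <= size p).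
  have := red _ _ _ di _ _ ne.
  by rewrite sedge_sym ad1 ad2 ad prednK // !eqxx => /(_ isT isT)/eqP; clear -i0; lia.
have [/existsP[a /existsP[b /existsP[l T]]]|noT] :=
  boolP [exists a : G, exists b : G, exists l : G, triangle a b l]; last first.
  have {}noT x y z : triangle x y z -> False.
    by move=> T; case/existsP: noT; exists x; apply/existsP; exists y; apply/existsP; exists z.
  have [r _|none] := pickP (fun _ : G => true).
    by apply: (star_windmill conG chG (r := r)) => [x y z /noT|a b /noT].
  apply/star_colorableP; exists (fun _ => ord0); split=> x; by have := none x.
have [/existsP[a' /existsP[b' /existsP[l' /andP[T' T12]]]]|all_same] :=
  boolP [exists a' : G, exists b' : G, exists l' : G,
    triangle a' b' l' && ~~ all [in [:: a; b; l]] [:: a'; b'; l']].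
  have [r hub tip] := windmill_hub meet T T' T12.
  exact: (star_windmill conG chG hub tip).
apply: (star_unicyclic conG chG T) => x y z T'; apply: contraNT all_same => T12.
by apply/existsP; exists x; apply/existsP; exists y; apply/existsP; exists z; rewrite T'.
Qed.

End Triangles.

(** By induction on the number of vertices, splitting at a vertex [z] of degree 2
    with non-adjacent neighbours [u] and [v]. The set [C] is the component of
    [u] without [z]; it does not contain [v], as a detour would make [u] and
    [v] adjacent. *)
Lemma star_colorable_of_free (G : sgraph) :
  connected_graph G -> chordal G -> free_of F3ch G -> star_colorable G 3.
Proof.
have [n] := ubnP #|G|; elim: n G => // n IH G; rewrite ltnS => Gn conG chG frG.
have [/existsP[z /existsP[u /existsP[v /and5P[/eqP dz zu zv nuv uv]]]]|none] :=
  boolP [exists z : G, exists u : G, exists v : G,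
    [&& degree z == 2, z -- u, z -- v, u != v & ~~ (u -- v)]]; last first.
  apply: star_reduced => // z u v dz zu zv nuv; apply: contraNT none => uv.
  by apply/existsP; exists z; apply/existsP; exists u; apply/existsP; exists v; rewrite dz zu zv nuv uv.
have only x : z -- x -> x = u \/ x = v := degree2_adj dz zu zv nuv.
pose C := [set x | con [set~ z] u x].
have zC : z \notin C.
  rewrite inE; apply/negP => /con_in; rewrite eq_sym (adj_neq zu) => /(_ isT).
  by rewrite !inE eqxx andbF.
have uC : u \in C by rewrite inE con0.
have vC : v \notin C.
  rewrite inE; apply: contra uv => uv; apply: (chordal_detour chG zu zv nuv _ uv).
    by rewrite !inE eqxx.
  by move=> x _; apply: only.
have closed x y : x \in C -> x -- y -> y != z -> y \in C.
  rewrite !inE => ux xy yz; apply: con_trans (ux) (con1 _ _ xy); rewrite !inE //.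
  by apply: contraNneq zC => E; rewrite inE -{2}E.
have side (A : {set G}) : (forall x, x \in A -> con A x z) -> (exists x, x \notin A) ->
    exists c : G -> 'I_3, star_on A c.
  move=> conA [x0 x0A]; apply: star_induced; apply: IH.
  - rewrite card_sig; apply: leq_trans Gn; apply: proper_card; apply/properP; split; last by exists x0.
    exact/subsetP.
  - apply: connected_induced => x1 y xA yA; apply: con_trans (conA x1 xA) _.
    by rewrite con_sym conA.
  - exact: chordal_induced.
  - exact: free_induced.
have inside x : x \in C -> con (z |: C) x z.
  rewrite inE => /connectP[p pP ->]; elim/last_ind: p pP => [_|p y IHp] /=.
    by apply: con1; rewrite ?in_setU1 ?eqxx ?uC ?orbT // sedge_sym.
  rewrite rcons_path last_rcons /= => /andP[pP /andP[/andP[_ yz] ly]].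
  have lC : last u p \in C by rewrite inE; apply/connectP; exists p.
  have yC : y \in C by apply: closed lC ly _; rewrite !inE in yz.
  apply: con_trans (IHp pP); apply: con1; rewrite ?in_setU1 ?lC ?yC ?orbT //.
  by rewrite sedge_sym.
have outside x : x \notin C -> con (~: C) x z.
  have /connectP[p pP zE] := conG x z.
  elim: p x pP zE => [|y p IHp] x /=; first by move=> _ ->; rewrite con0.
  case/andP=> xy pP zE xC; have [->|xz] := eqVneq x z; first exact: con0.
  have yC : y \notin C.
    by apply: contra xC => yC; apply: closed yC _ xz; rewrite sedge_sym.
  by apply: con_trans (IHp y pP zE yC); apply: con1; rewrite // in_setC.
apply: (@star_glue _ (z |: C) (~: C) z u v) => //.
- by move=> x; rewrite in_setU1 in_setC; case: (x \in C); [left; rewrite orbT|right].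
- by move=> x; rewrite in_setU1 in_setC => /orP[/eqP//|->].
- by rewrite in_setU1 eqxx.
- by rewrite in_setC.
- by rewrite in_setU1 uC orbT.
- by rewrite in_setC.
- move=> x y xy; rewrite !in_setU1 !in_setC.
  have [xC|xC] := boolP (x \in C); have [yC|yC] := boolP (y \in C); rewrite ?orbT ?orbF /=;
    [by left|left|left|by right].
    by apply: contraR yC; apply: closed xC xy.
  by rewrite andbT; apply: contraR xC; apply: closed yC _; rewrite sedge_sym.
- apply: side; last by exists v; rewrite in_setU1 negb_or eq_sym adj_neq.
  by move=> x; rewrite in_setU1 => /orP[/eqP->|/inside//]; apply: con0.
- apply: side; last by exists u; rewrite in_setC uC.
  by move=> x; rewrite in_setC; apply: outside.
Qed.

(** * The forbidden graphs have no star colouring with three colours *)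

(** The spine [u] and the feet [v] are indexed by numbers, so that inductions can
    run along the spine. *)
Lemma D_copy m (G : sgraph) : induced_copy (D m.+4) G ->
  exists u v : nat -> G,
  [/\ forall i j, i < j <= m.+3 -> u i != u j /\ (u i -- u j) = (j == i.+1),
      forall i j, i <= m.+3 -> j <= m.+1 ->
        u i != v j /\ (u i -- v j) = (minn i.-1 m.+1 == j)
    & forall i j, i < j <= m.+1 -> v i != v j].
Proof.
case=> f finj fE.
exists (fun i => f (inl (inord i))), (fun j => f (inr (inord j : 'I_m.+2))); split.
- move=> i j /andP[ij jm].
  have inE_ : (@inord m.+3 i == inord j) = false.
    by apply/eqP => /(congr1 val) /=; rewrite !inordK; lia.
  split; first by rewrite (inj_eq finj) -[_ == _]/(@inord m.+3 i == inord j) inE_.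
  rewrite fE /= /symirr_rel /= !inordK; try lia.
  rewrite -[inl _ == _]/(@inord m.+3 i == inord j) inE_ /= eq_sym.
  by rewrite [j.+1 == i](_ : _ = false) ?orbF //; lia.
- move=> i j im jm; split; first by rewrite (inj_eq finj).
  rewrite fE /= /symirr_rel /= orbF !inordK; try lia.
- move=> i j /andP[ij jm]; rewrite (inj_eq finj).
  rewrite -[_ == _]/(@inord m.+1 i == inord j).
  by apply/eqP => /(congr1 val) /=; rewrite !inordK; lia.
Qed.

Lemma ord3_cover (a b c d : 'I_3) : a != b -> a != c -> b != c -> d != a -> d != b -> d = c.
Proof.
rewrite -!val_eqE /= => ab ac bc da db; apply: val_inj => /=.
by have := (ltn_ord a, ltn_ord b, ltn_ord c, ltn_ord d); case=> [[[? ?] ?] ?]; lia.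
Qed.

Section NotStar.
Variable G : sgraph.
Implicit Types (a b p q s t u v w x y z : G).
Variable c : G -> 'I_3.
Hypothesis star_c : star_on setT c.

Lemma star_proper x y : x -- y -> c x != c y.
Proof. by case: star_c => pr _; apply: pr. Qed.

Lemma star_path x y z w : x -- y -> y -- z -> z -- w -> x != z -> y != w -> c x = c z -> c y != c w.
Proof.
case: star_c => pr st xy yz zw nxz nyw xz; apply/eqP => yw.
apply: (st x y z w) => //=; first by rewrite !inE.
have nxw : x != w by apply: contraTneq (star_proper xy) => ->; rewrite yw eqxx.
by rewrite !inE !negb_or (adj_neq xy) (adj_neq yz) (adj_neq zw) nxz nyw nxw.
Qed.

(** When [v] and [w] are adjacent, [w] is a leaf of their two-coloured star. *)
Definition leaf_of w v := forall y, y -- w -> y != v -> c y != c v.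

(** The colour of [w] reappears on [a] or [b], so a second neighbour of [w] in the
    colour of [v] would start a two-coloured path through [w, v] to it. *)
Lemma leaf_triangle v a b w : v -- a -> v -- b -> a -- b -> v -- w -> w != a -> w != b ->
  leaf_of w v.
Proof.
move=> va vb ab vw wa wb y yw yv; apply/eqP => cyv.
have cva := star_proper va; have cvb := star_proper vb; have cvw := star_proper vw.
have cab := star_proper ab.
have no x : v -- x -> w != x -> c w <> c x.
  move=> vx wx; apply/eqP; apply: (@star_path y w v x) => //.
  by rewrite sedge_sym.
case: (no a va wa); apply: ord3_cover cvb _ _ _ _; rewrite ?[_ == c v]eq_sym // ?[c b == _]eq_sym //.
by apply/eqP; apply: no.
Qed.

(** [v] already uses up the colour of [v'] on [v'] alone, so [w] and [x] share the
    third colour. *)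
Lemma leaf_step v v' w x : leaf_of v v' -> v -- v' -> v -- w -> v -- x -> w != x ->
  w != v' -> x != v' -> leaf_of w v.
Proof.
move=> leaf vv' vw vx wx wv' xv' y yw yv; apply/eqP => cyv.
have cwx : c w = c x.
  have cv := star_proper vv'; have cvw := star_proper vw; have cvx := star_proper vx.
  apply: (@ord3_cover (c v) (c v')) => //; rewrite 1?[_ == c v]eq_sym //.
  - by rewrite eq_sym leaf // sedge_sym.
  - by rewrite leaf // sedge_sym.
by have := @star_path y w v x yw _ vx yv wx cyv; rewrite sedge_sym cwx eqxx => /(_ vw).
Qed.

(** The other corners of the triangle at [w] use both colours different from that
    of [w], one of which is the colour of [v]. *)
Lemma leaf_triangleF v w p q : leaf_of w v -> v -- w -> w -- p -> w -- q -> p -- q ->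
  v != p -> v != q -> False.
Proof.
move=> leaf vw wp wq pq vp vq.
have [cvw cwp cwq cpq] := And4 (star_proper vw) (star_proper wp) (star_proper wq) (star_proper pq).
case/eqP: cpq; apply: (@ord3_cover (c v) (c w)) => //; rewrite 1?[_ == c w]eq_sym //.
- by rewrite eq_sym leaf 1?eq_sym // sedge_sym.
- by rewrite leaf 1?eq_sym // sedge_sym.
Qed.
End NotStar.

Lemma star_induced_copy (H G : sgraph) (C : eqType) (c : G -> C) :
  star_on setT c -> induced_copy H G -> exists c : H -> C, star_on setT c.
Proof.
case=> pr st [f finj fE]; exists (fun x => c (f x)); split.
  by move=> x y _ _ xy; apply: pr; rewrite ?inE ?fE.
move=> x y z w _ U *; apply: (st (f x) (f y) (f z) (f w)); rewrite ?fE //.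
  by rewrite /= !inE.
by rewrite -(map_inj_uniq finj) in U.
Qed.

(** In the kite and the gem, equal colours are forced on vertices of two adjacent
    triangles and produce a two-coloured path. In [X127] the vertices
    [1] and [2] are leaves at [0], so their pendant vertices repeat the colours
    of [2] and [1] and end a two-coloured path. In [D k] the leaf property runs along the spine from one triangle to the
    other. *)
Lemma free_of_star_colorable (G : sgraph) : star_colorable G 3 -> free_of F3ch G.
Proof.
case/star_colorableP=> c0 star0 H FH HG.
have [c sc] := star_induced_copy star0 HG.
case: FH HG c sc => [HG|HG|HG|HG|k k4 HG] c sc.
- pose o i (lt : i < 4) : K4 := Ordinal lt.
  have pr := star_proper sc.
  have /eqP := pr (o 2 isT) (o 3 isT) isT; apply.
  by apply: (@ord3_cover (c (o 0 isT)) (c (o 1 isT))); apply: pr.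
- pose o i (lt : i < 5) : kite := Ordinal lt.
  have pr x y : x -- y -> c x != c y := @star_proper _ _ sc x y.
  have lm : c (o 0 isT) = c (o 3 isT).
    by apply: (@ord3_cover (c (o 1 isT)) (c (o 2 isT))); apply: pr.
  have ws : c (o 4 isT) != c (o 1 isT).
    apply/eqP => ws; have := @star_path _ _ sc (o 4 isT) (o 3 isT) (o 1 isT) (o 0 isT) isT isT isT isT isT ws.
    by rewrite lm eqxx.
  have := @star_path _ _ sc (o 4 isT) (o 3 isT) (o 2 isT) (o 0 isT) isT isT isT isT isT.
  rewrite lm eqxx => /(_ _) E; suff : false by []. apply: E.
  by apply: (@ord3_cover (c (o 1 isT)) (c (o 3 isT))); rewrite ?ws //; apply: pr.
- pose o i (lt : i < 5) : gem := Ordinal lt.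
  have pr x y : x -- y -> c x != c y := @star_proper _ _ sc x y.
  have e1 : c (o 0 isT) = c (o 2 isT).
    by apply: (@ord3_cover (c (o 4 isT)) (c (o 1 isT))); apply: pr.
  have e2 : c (o 1 isT) = c (o 3 isT).
    by apply: (@ord3_cover (c (o 4 isT)) (c (o 2 isT))); apply: pr.
  have := @star_path _ _ sc (o 0 isT) (o 1 isT) (o 2 isT) (o 3 isT) isT isT isT isT isT e1.
  by rewrite e2 eqxx.
- pose o i (lt : i < 7) : X127 := Ordinal lt.
  have pr x y : x -- y -> c x != c y := @star_proper _ _ sc x y.
  have la := @leaf_triangle _ _ sc (o 0 isT) (o 3 isT) (o 4 isT) (o 1 isT) isT isT isT isT isT isT (o 5 isT) isT isT.
  have lb := @leaf_triangle _ _ sc (o 0 isT) (o 3 isT) (o 4 isT) (o 2 isT) isT isT isT isT isT isT (o 6 isT) isT isT.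
  have e1 : c (o 5 isT) = c (o 2 isT).
    by apply: (@ord3_cover (c (o 0 isT)) (c (o 1 isT))); rewrite // ?pr.
  have e2 : c (o 1 isT) = c (o 6 isT).
    by apply/esym/(@ord3_cover (c (o 0 isT)) (c (o 2 isT))); rewrite // ?pr.
  have := @star_path _ _ sc (o 5 isT) (o 1 isT) (o 2 isT) (o 6 isT) isT isT isT isT isT e1.
  by rewrite e2 eqxx.
- case: k k4 HG c sc => [|[|[|[|m]]]] // _ HG c sc.
  have [u [v [uu uv vv]]] := D_copy HG.
  have path i : i <= m.+2 -> u i -- u i.+1.
    by move=> im; have [_ ->] := uu i i.+1 ltac:(lia).
  have uvE i j : i <= m.+3 -> minn i.-1 m.+1 = j -> u i -- v j.
    by move=> im <-; have [_ ->] := uv i (minn i.-1 m.+1) im ltac:(lia).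
  have leaf i : i <= m -> leaf_of c0 (u i.+2) (u i.+1).
    elim: i => [_|i IH im].
      apply: (@leaf_triangle _ _ star0 (u 1) (u 0) (v 0)).
      + by rewrite sedge_sym path.
      + by apply: uvE; lia.
      + by apply: uvE; lia.
      + exact: path.
      + by have [] := uu 0 2 ltac:(lia); rewrite eq_sym.
      + by have [] := uv 2 0 ltac:(lia) ltac:(lia).
    apply: (@leaf_step _ _ star0 (u i.+2) (u i.+1) (u i.+3) (v i.+1)).
    + by apply: IH; lia.
    + by rewrite sedge_sym path //; lia.
    + by apply: path; lia.
    + by apply: uvE; lia.
    + by have [] := uv i.+3 i.+1 ltac:(lia) ltac:(lia).
    + by have [] := uu i.+1 i.+3 ltac:(lia); rewrite eq_sym.
    + by have [] := uv i.+1 i.+1 ltac:(lia) ltac:(lia); rewrite eq_sym.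
  apply: (@leaf_triangleF _ _ star0 (u m.+1) (u m.+2) (u m.+3) (v m.+1) (leaf m (leqnn m))).
  + by apply: path; lia.
  + by apply: path; lia.
  + by apply: uvE; lia.
  + by apply: uvE; lia.
  + by have [] := uu m.+1 m.+3 ltac:(lia).
  + by have [] := uv m.+1 m.+1 ltac:(lia) ltac:(lia).
Qed.

Lemma chi_star_le3 (G : sgraph) : chi_star G <= 3 <-> star_colorable G 3.
Proof.
rewrite /chi_star; case: ex_minnP => k kP kmin; split=> [k3|]; last exact: kmin.
have [c [pr st]] := (star_colorableP G k).1 kP.
apply/star_colorableP; exists (fun x => widen_ord k3 (c x)); split.
  move=> x y xA yA xy; apply: contraNneq (pr x y xA yA xy) => /(congr1 val) /= E.
  exact/eqP/val_inj.
move=> x y z w A U xy yz zw /(congr1 val) /= E1 /(congr1 val) /= E2.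
by apply: (st x y z w) => //; apply: val_inj.
Qed.

(** * Blocks *)
Section Blocks.
Variable G : sgraph.
Implicit Types (a b l m s t u v w x y z : G) (A B C K S : {set G}) (p : seq G).

(** The blocks are the maximal sets with this property. *)
Definition cutless A : bool :=
  [&& A != set0, connected_in A & [forall v in A, connected_in (A :\ v)]].

Lemma connected_inP A :
  reflect {in A &, forall x y, con A x y} (connected_in A).
Proof.
apply: (iffP forall_inP) => [conA x y xA yA|conA x xA].
  by have /forall_inP := conA x xA; apply.
by apply/forall_inP => y yA; apply: conA.
Qed.

Lemma cutlessP A : reflect [/\ A != set0, {in A &, forall x y, con A x y}
    & forall v, {in A :\ v &, forall x y, con (A :\ v) x y}] (cutless A).
Proof.
apply: (iffP and3P) => [[A0 /connected_inP conA /forall_inP cutA]|[A0 conA cutA]]; split=> //.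
- move=> v; have [vA|vA] := boolP (v \in A); first exact/connected_inP/cutA.
  by rewrite (_ : A :\ v = A) //; apply/setDidPl; rewrite disjoint_sym disjoints1.
- exact/connected_inP.
- by apply/forall_inP => v _; apply/connected_inP/cutA.
Qed.

Lemma cutless_edge x y : x -- y -> cutless [set x; y].
Proof.
move=> xy; apply/cutlessP; split.
- by apply/set0Pn; exists x; rewrite !inE eqxx.
- move=> u v; rewrite !inE => /orP[]/eqP-> /orP[]/eqP->; rewrite ?con0 //.
    by apply: con1; rewrite ?inE ?eqxx ?orbT.
  by apply: con1; rewrite ?inE ?eqxx ?orbT // sedge_sym.
- move=> v u w; rewrite !inE => /andP[uv /orP[]/eqP uE] /andP[wv /orP[]/eqP wE];
    rewrite uE wE ?con0 // in uv wv *.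
    by apply: con1; rewrite // !inE ?uv ?wv eqxx ?orbT.
  by apply: con1; rewrite ?inE ?uv ?wv ?eqxx ?orbT // sedge_sym.
Qed.

Lemma cutless_union A B x y : cutless A -> cutless B -> x != y ->
  x \in A -> x \in B -> y \in A -> y \in B -> cutless (A :|: B).
Proof.
move=> /cutlessP[A0 cA cutA] /cutlessP[B0 cB cutB] xy xA xB yA yB.
apply/cutlessP; split.
- by apply/set0Pn; exists x; rewrite inE xA.
- have to_x u : u \in A :|: B -> con (A :|: B) u x.
    rewrite inE => /orP[uA|uB].
      exact: con_sub (subsetUl _ _) (cA _ _ uA xA).
    exact: con_sub (subsetUr _ _) (cB _ _ uB xB).
  by move=> u v uU vU; apply: con_trans (to_x u uU) _; rewrite con_sym to_x.
move=> v; have [t [tv tA tB]] : exists t, [/\ t != v, t \in A & t \in B].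
  have [E|xv] := eqVneq x v; last by exists x.
  by exists y; rewrite eq_sym -E.
have to_t u : u \in (A :|: B) :\ v -> con ((A :|: B) :\ v) u t.
  rewrite !inE => /andP[uv /orP[uA|uB]].
    by apply: con_sub (setSD _ (subsetUl _ _)) (cutA v _ _ _ _); rewrite !inE ?uv ?tv.
  by apply: con_sub (setSD _ (subsetUr _ _)) (cutB v _ _ _ _); rewrite !inE ?uv ?tv.
by move=> u w uU wU; apply: con_trans (to_t u uU) _; rewrite con_sym to_t.
Qed.

(** The inner vertices of the ear may lie in [A] too. After the removal of a
    vertex [v], each vertex of the ear still reaches [A] along the side of the
    ear that does not contain [v]. *)
Lemma cutless_ear A x y p : cutless A -> x \in A -> y \in A ->
  path (@sedge G) x (rcons p y) -> uniq (x :: rcons p y) ->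
  cutless (A :|: [set z in p]).
Proof.
move=> /cutlessP[A0 cA cutA] xA yA pP U.
have anchor v z : z \in p -> z != v ->
    exists a, [/\ a \in A, a != v & con ((A :|: [set u in p]) :\ v) z a].
  move=> zp zv; case/splitPr: zp pP U => p1 p2; rewrite rcons_cat rcons_cons.
  rewrite cat_path /= => /and3P[pP1 lz pP2] /andP[xN U].
  set E := A :|: _; have AE : A \subset E by apply: subsetUl.
  have inE_ u : u \in p1 \/ u \in p2 -> u != v -> u \in E :\ v.
    by move=> up uv; rewrite !inE uv mem_cat inE; case: up => ->; rewrite ?orbT.
  have zE : z \in E :\ v by rewrite !inE zv mem_cat !inE eqxx !orbT.
  have [v1|v1] := boolP (v \in x :: p1).
    have v2 : v \notin rcons p2 y.
      move: v1; rewrite inE => /orP[/eqP->|v1].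
        by apply: contra xN => xp2; rewrite mem_cat inE xp2 !orbT.
      move: U; rewrite cat_uniq => /and3P[_ /hasPn H _]; apply/negP => vp2.
      by have := H v; rewrite inE vp2 orbT v1 => /(_ isT).
    exists y; split=> //; first by apply: contraNneq v2 => <-; rewrite mem_rcons mem_head.
    rewrite -(last_rcons z p2 y); apply: path_con => //; rewrite /= zE /=.
    apply/allP => u up2; have uv : u != v by apply: contraNneq v2 => <-.
    move: up2; rewrite mem_rcons inE => /orP[/eqP E_|up2]; last by apply: inE_ => //; right.
    by rewrite /= in_setD1 uv (subsetP AE) // E_.
  exists x; split=> //; first by apply: contraNneq v1 => <-; rewrite mem_head.
  rewrite con_sym; apply: (@con_trans _ _ (last x p1)).
    apply: path_con => //; apply/allP => u up; have uv : u != v by apply: contraNneq v1 => <-.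
    move: up; rewrite inE => /orP[/eqP E_|up]; last by apply: inE_ => //; left.
    by rewrite /= in_setD1 uv (subsetP AE) // E_.
  apply: con1 => //; have := mem_last x p1; rewrite inE => /orP[/eqP->|lp].
    by rewrite in_setD1 (subsetP AE) // andbT; apply: contraNneq v1 => <-; rewrite mem_head.
  by apply: inE_; [left|apply: contraNneq v1 => <-; rewrite inE lp orbT].
pose E := A :|: [set z in p]; have AE : A \subset E by apply: subsetUl.
apply/cutlessP; split.
- by case/set0Pn: A0 => z zA; apply/set0Pn; exists z; rewrite inE zA.
- have to_A u : u \in E -> exists2 a, a \in A & con E u a.
    rewrite inE => /orP[uA|]; first by exists u; rewrite ?con0.
    rewrite inE => up; have [->|ux] := eqVneq u x; first by exists x; rewrite ?con0.
    have [a [aA _ ua]] := anchor x u up ux; exists a => //.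
    by apply: con_sub ua; apply: subD1set.
  move=> u w /to_A[a aA ua] /to_A[b bA wb].
  apply: con_trans ua (con_trans (con_sub AE (cA _ _ aA bA)) _); by rewrite con_sym.
move=> v; have to_A u : u \in E :\ v -> exists2 a, a \in A :\ v & con (E :\ v) u a.
  rewrite in_setD1 in_setU => /andP[uv /orP[uA|]].
    by exists u; rewrite ?con0 // in_setD1 uv.
  rewrite inE => up; have [a [aA av ua]] := anchor v u up uv.
  by exists a; rewrite // in_setD1 av.
move=> u w /to_A[a aA ua] /to_A[b bA wb].
apply: con_trans ua (con_trans (con_sub (setSD _ AE) (cutA v _ _ aA bA)) _).
by rewrite con_sym.
Qed.

Lemma block_cutless B : block B -> cutless B.
Proof. by case/maxsetP. Qed.

Lemma block_max B A : block B -> cutless A -> B \subset A -> A = B.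
Proof. by case/maxsetP=> _ maxB cA BA; apply: maxB. Qed.

Lemma cutless_block A : cutless A -> exists2 B, block B & A \subset B.
Proof. by move=> cA; have [B] := maxset_exists cA; exists B. Qed.

Lemma block_con B x y : block B -> x \in B -> y \in B -> con B x y.
Proof. by move=> /block_cutless/cutlessP[_ cB _]; apply: cB. Qed.

Lemma block_conD B v x y : block B -> x \in B -> y \in B -> x != v -> y != v ->
  con (B :\ v) x y.
Proof.
move=> /block_cutless/cutlessP[_ _ cB] xB yB xv yv.
by apply: cB; rewrite in_setD1 ?xv ?yv.
Qed.

Lemma block_share B B' x y : block B -> block B' -> x != y ->
  x \in B -> x \in B' -> y \in B -> y \in B' -> B = B'.
Proof.
move=> bB bB' xy xB xB' yB yB'.
have cU := cutless_union (block_cutless bB) (block_cutless bB') xy xB xB' yB yB'.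
by rewrite -(block_max bB cU (subsetUl _ _)) -[RHS](block_max bB' cU (subsetUr _ _)).
Qed.

(** A walk leaving [B] through [u] and coming back elsewhere without using [u]
    contains an ear, which would enlarge the block. *)
Lemma block_gate B u w y : block B -> u \in B -> w \notin B -> u -- w ->
  y \in B -> y != u -> con [set~ u] w y -> False.
Proof.
move=> bB uB wB uw yB yu wy.
have wu : w \in [set~ u] by rewrite !inE eq_sym adj_neq.
have [p [sp pP pA py]] := con_path wu wy.
case/lastP: p => [|p z] in sp pP pA py *; first by move: wB; rewrite -[w]/(last w [::]) py yB.
rewrite last_rcons in py; subst z.
have U := shortest_uniq sp.
case/negP: wB; rewrite -(block_max bB (@cutless_ear B u y (w :: p) _ uB yB _ _)).
- by rewrite !inE eqxx orbT.
- exact: block_cutless.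
- by rewrite /= uw.
- rewrite rcons_cons cons_uniq U andbT; apply/negP => /(allP pA).
  by rewrite /= !inE eqxx.
- exact: subsetUl.
Qed.

(** The part of a path in [A] before it enters [C] for the first time. *)
Lemma con_exit A C w c : con A w c -> w \in A -> w \notin C -> c \in C ->
  exists w' y, [/\ con (A :\: C) w w', w' \in A :\: C, y \in A, y \in C & w' -- y].
Proof.
case/connectP=> p + ->; elim: p w => [|z p IH] w /=; first by move=> _ _ /negP.
case/andP=> /andP[/andP[wA zA] wz] pP _ wC lC.
have wD : w \in A :\: C by rewrite in_setD wC.
have [zC|zC] := boolP (z \in C); first by exists w, z; split; rewrite ?con0.
have [w' [y [zw' w'D yA yC w'y]]] := IH z pP zA zC lC.
exists w', y; split=> //; apply: con_trans (con1 _ _ wz) zw' => //.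
by rewrite in_setD zC.
Qed.

Lemma con_step A x y : con A x y -> x != y -> exists2 z, z \in A & x -- z.
Proof.
case/connectP=> -[|z p] /= pP ->; first by rewrite eqxx.
by case/andP: pP => /andP[/andP[_ zA] xz] _ _; exists z.
Qed.

Lemma block_nbr B x y : block B -> x \in B -> y \in B -> x != y ->
  exists2 z, z \in B & x -- z.
Proof. by move=> bB xB yB; apply: con_step; apply: block_con. Qed.

Lemma block_two B x : connected_graph G -> #|G| <> 1 -> block B -> x \in B ->
  exists2 y, y \in B & x -- y.
Proof.
move=> conG G1 bB xB.
have [/existsP[y /andP[yB yx]]|no] := boolP [exists y, (y \in B) && (y != x)].
  by apply: (block_nbr bB xB yB); rewrite eq_sym.
have [y yx] : exists y, y != x.
  apply/existsP; apply: contra_notT G1; rewrite negb_exists => /forallP all_x.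
  by apply/eqP/fintype1P; exists x => y; apply/eqP; have := all_x y; rewrite negbK.
have xyT : con setT x y.
  by apply: connect_sub (conG x y) => u v uv; apply: con1; rewrite ?inE.
have [|z _ xz] := con_step xyT; first by rewrite eq_sym.
exists z => //; rewrite -(block_max bB (cutless_edge xz)) ?inE ?eqxx ?orbT //.
apply/subsetP => u uB; have := existsPn no u; rewrite uB /= negbK => /eqP->.
by rewrite !inE eqxx.
Qed.

Lemma crown_of_base B s t : s \in B -> t \in B -> s -- t ->
  (forall x, x \in B -> x != s -> x != t -> (x -- s) && (x -- t)) ->
  (forall x y, x \in B -> y \in B -> x != s -> x != t -> y != s -> y != t -> ~~ (x -- y)) ->
  crown_with_base #|B :\: [set s; t]| B [set s; t].
Proof.
move=> sB tB st apex indep; apply/and5P; split=> //.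
- by rewrite subUset !sub1set sB tB.
- by rewrite cards2 adj_neq.
- apply/forall_inP => x xS; apply/forall_inP => y yB; apply/implyP => xy.
  rewrite eq_sym in xy; move: xS xy; rewrite !inE => /orP[]/eqP-> ny.
    have [->|nty] := eqVneq y t; first by [].
    by have /andP[ys _] := apex y yB ny nty; rewrite sedge_sym.
  have [->|nsy] := eqVneq y s; first by rewrite sedge_sym.
  by have /andP[_ yt] := apex y yB nsy ny; rewrite sedge_sym.
- apply/forall_inP => x; rewrite !inE negb_or => /andP[/andP[xs xt] xB].
  apply/forall_inP => y; rewrite !inE negb_or => /andP[/andP[ys yt] yB].
  exact: indep.
Qed.

Lemma crown_with_baseP n B S : crown_with_base n B S -> exists s t,
  [/\ S = [set s; t], s \in B /\ t \in B, s -- t,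
      forall x, x \in B -> x != s -> x != t -> s -- x /\ t -- x &
      forall x y, x \in B -> y \in B -> x != s -> x != t -> y != s -> y != t -> ~~ (x -- y)].
Proof.
case/and5P=> SB /cards2P[s [t [nst SE]]] _ adjS indep; exists s, t.
have sS : s \in S by rewrite SE !inE eqxx.
have tS : t \in S by rewrite SE !inE eqxx orbT.
have adjS' x y : x \in S -> y \in B -> x != y -> x -- y.
  by move=> xS yB xy; have /forall_inP/(_ y yB)/implyP/(_ xy) := forall_inP adjS x xS.
have [sB tB] : s \in B /\ t \in B by rewrite !(subsetP SB).
split=> //; first exact: adjS'.
  by move=> x xB xs xt; split; apply: adjS'; rewrite // eq_sym.
move=> x y xB yB xs xt ys yt.
have xD : x \in B :\: S by rewrite SE !inE negb_or xs xt.
have yD : y \in B :\: S by rewrite SE !inE negb_or ys yt.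
by have /forall_inP := forall_inP indep x xD; apply.
Qed.

End Blocks.

(** * Blocks of free chordal graphs are crowns *)
Section BlocksAreCrowns.
Variable G : sgraph.
Hypotheses (chG : chordal G) (frG : free_of F3ch G).
Implicit Types (a b l m s t u v w x y z : G) (A B C K S : {set G}) (p : seq G).

(** Choose an edge [s -- t] of the block with as many common neighbours as
    possible; together they form a crown [C]. If [C] were not the whole block, a
    component of the rest would be attached to two vertices [x] and [y] of [C],
    since blocks have no cut vertex. If [x] and [y] are not adjacent, they are
    apexes of a diamond and have no neighbours outside [C]. If they are
    adjacent, they have a common neighbour [z] outside [C] by chordality; this
    contradicts the definition of [C] for the edge [s -- t], and for an edge
    from the base to an apex it contradicts the fact on diamonds or the
    maximality. *)
Lemma block_crown B x0 y0 : block B -> x0 \in B -> y0 \in B -> x0 -- y0 -> crown B.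
Proof.
move=> bB x0B y0B x0y0.
pose ok (e : G * G) := [&& e.1 \in B, e.2 \in B & e.1 -- e.2].
pose N (e : G * G) := [set z in B | triangle e.1 e.2 z].
have ok0 : ok (x0, y0) by rewrite /ok x0B y0B.
case: (@arg_maxnP _ (x0, y0) ok (fun e => #|N e|) ok0) => -[s t] /and3P[/= sB tB st] maxN.
have NP z : z \in N (s, t) -> [/\ z \in B, z -- s & z -- t].
  by rewrite inE => /andP[zB /triangleP[_ sz tz]]; split=> //; rewrite sedge_sym.
have NI z : z \in B -> z -- s -> z -- t -> z \in N (s, t).
  by move=> zB zs zt; rewrite inE zB; apply/triangleP; split=> //=; rewrite sedge_sym.
pose C := s |: (t |: N (s, t)).
have CP z : reflect [\/ z = s, z = t | z \in N (s, t)] (z \in C).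
  rewrite !in_setU1; apply: (iffP or3P) => [[/eqP|/eqP|]|[->|->|zN]].
  - exact: Or31.
  - exact: Or32.
  - exact: Or33.
  - by apply: Or31.
  - by apply: Or32.
  - by apply: Or33.
have sC : s \in C by apply/CP/Or31.
have tC : t \in C by apply/CP/Or32.
have indep x y : x \in N (s, t) -> y \in N (s, t) -> ~~ (x -- y).
  move=> /NP[_ xs xt] /NP[_ ys yt]; apply/negP => xy.
  by apply: (no_K4 frG st (_ : s -- x) (_ : s -- y)); adj.
suff BC : B \subset C.
  exists #|B :\: [set s; t]|; apply/existsP; exists [set s; t].
  have inN x : x \in B -> x != s -> x != t -> x \in N (s, t).
    move=> /(subsetP BC)/CP[->|->|//]; by rewrite eqxx.
  apply: crown_of_base => //.
    by move=> x xB xs xt; have [_ -> ->] := NP _ (inN x xB xs xt).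
  by move=> x y xB yB xs xt ys yt; apply: indep; apply: inN.
apply/subsetP => w0 w0B; apply: contraT => w0C; exfalso.
have [w [x [_ wD xB xC wx]]] := con_exit (block_con bB w0B sB) w0B w0C sC.
have /setDP[wB wC] := wD.
have [c [cC cB cx]] : exists c, [/\ c \in C, c \in B & c != x].
  have [E|xs] := eqVneq s x; last by exists s.
  by exists t; rewrite -E eq_sym adj_neq.
have wx' : w != x by apply: adj_neq.
have [w' [y [ww' w'D yB yC w'y]]] :=
  con_exit (block_conD bB wB cB wx' cx) (introT setD1P (conj wx' wB)) wC cC.
have [nyx {}yB] : y != x /\ y \in B by move: yB; rewrite in_setD1 => /andP[].
have {}ww' : con (B :\: C) w w' by apply: con_sub ww'; apply/setSD/subD1set.
(* With a second apex [k] around, an apex [z] has no neighbours outside [C]. *)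
have apex_out z k : z \in N (s, t) -> k \in N (s, t) -> k != z -> forall q, z -- q -> q \in C.
  move=> /NP[_ zs zt] /NP[_ ks kt] kz q zq; apply/CP.
  by case: (diamond_adj chG frG st ks kt zs zt kz zq) => ->; [apply: Or31|apply: Or32].
have [z1 z2] : w \notin C /\ w' \notin C by split=> //; case/setDP: w'D.
have nonadj : ~~ (x -- y) -> x \in N (s, t) /\ y \in N (s, t).
  have one u v : u \in C -> v \in C -> v != u -> ~~ (u -- v) -> u \in N (s, t).
    move=> uC /CP vC vu uv; case/CP: uC uv vu vC => [->|->|//] uv vu [vE|vE|/NP[_ vs vt]].
    - by rewrite vE eqxx in vu.
    - by rewrite vE st in uv.
    - by rewrite sedge_sym vs in uv.
    - by rewrite vE sedge_sym st in uv.
    - by rewrite vE eqxx in vu.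
    - by rewrite sedge_sym vt in uv.
  by move=> xy; split; [apply: one xC yC nyx xy|apply: one yC xC _ _; rewrite 1?eq_sym // sedge_sym].
have [xy|xy] := boolP (x -- y); last first.
  have [xN yN] := nonadj xy.
  by case/negP: z1; apply: apex_out xN yN nyx _ _; rewrite sedge_sym.
rewrite sedge_sym in wx; rewrite sedge_sym in w'y.
have [z [zD _ xz yz]] : exists z, [/\ z \in B :\: C, con (B :\: C) w z, x -- z & y -- z].
  apply: (chordal_common_nbr chG xy _ _ wD ww' wx w'y).
    by rewrite in_setD xC.
  by rewrite in_setD yC.
have /setDP[zB zC] := zD.
(* An edge from a base vertex [s'] to an apex [u]. If [u] is the only apex, then
   [t'] and [z] are two common neighbours of [s'] and [u], against the choice of
   [s -- t]. *)
have side s' t' u : s' -- t' -> t' \in B -> s' \in B -> u \in N (s, t) ->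
    (s' = s /\ t' = t) \/ (s' = t /\ t' = s) ->
    s' -- z -> u -- z -> False.
  move=> st' t'B s'B uN s't' s'z uz; have [uB us ut] := NP u uN.
  have [us' ut'] : u -- s' /\ u -- t' by case: s't' => -[-> ->].
  have [/existsP[k /andP[kN ku]]|only] := boolP [exists k, (k \in N (s, t)) && (k != u)].
    by case/negP: zC; apply: apex_out uN kN ku _ uz.
  have cN : #|N (s, t)| <= 1.
    rewrite -(cards1 u); apply: subset_leq_card; apply/subsetP => k kN.
    by have := existsPn only k; rewrite kN negbK in_set1.
  have := maxN (s', u); rewrite /ok /= s'B uB sedge_sym us' => /(_ isT) le.
  have zt' : z != t'.
    by apply: contraNneq zC => ->; case: s't' => -[_ ->].
  have : #|[set z; t']| <= #|N (s', u)|.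
    apply: subset_leq_card; apply/subsetP => k; rewrite !inE => /orP[]/eqP->.
      by rewrite zB; apply/triangleP; rewrite (sedge_sym s').
    by rewrite t'B; apply/triangleP; rewrite (sedge_sym s').
  by rewrite cards2 zt' => le2; have := leq_trans le2 (leq_trans le cN).
have ts : t -- s by rewrite sedge_sym.
case/CP: (xC) (yC) xy xz yz nyx => [xE|xE|xN] /CP[yE|yE|yN]; rewrite ?xE ?yE => xy xz yz nyx.
- by rewrite eqxx in nyx.
- by case/negP: zC; apply/CP/Or33/NI; rewrite // sedge_sym.
- by apply: (side s t y) => //; left.
- by case/negP: zC; apply/CP/Or33/NI; rewrite // sedge_sym.
- by rewrite eqxx in nyx.
- by apply: (side t s y) => //; right.
- by apply: (side s t x) => //; left.
- by apply: (side t s x) => //; right.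
- by have := indep x y xN yN; rewrite xy.
Qed.

End BlocksAreCrowns.

(** * Freeness implies the crown structure *)
Section CrownBlocks.
Variable G : sgraph.
Implicit Types (a b c d l m s t u v w x y z : G) (A B C K S : {set G}) (p : seq G).

Lemma crown_sizeE n B S : crown_with_base n B S -> n = #|B :\: S|.
Proof. by case/and5P=> _ _ /eqP. Qed.

Lemma nontrivial_triangle B x : nontrivial_block B -> crown B -> x \in B ->
  exists a b, [/\ a \in B, b \in B & triangle x a b].
Proof.
case/andP=> bB nt [n /existsP[S SB]] xB.
have [s [t [SE [sB tB] st apex _]]] := crown_with_baseP SB.
have [z zB [zs zt]] : exists2 z, z \in B & z != s /\ z != t.
  have [/existsP[z /andP[zB zS]]|no] := boolP [exists z, (z \in B) && (z \notin S)].
    by exists z => //; move: zS; rewrite SE !inE negb_or => /andP[].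
  case/negP: nt; apply/existsP; exists S.
  have := SB; rewrite (crown_sizeE SB) (_ : B :\: S = set0) ?cards0 //.
  apply/setP=> z; rewrite !inE; have := existsPn no z.
  by rewrite negb_and negbK; case: (z \in B); rewrite ?andbF //= => ->.
have [zs' zt'] := apex z zB zs zt.
have [->|xs] := eqVneq x s; first by exists t, z; split=> //; apply/triangleP.
have [->|xt] := eqVneq x t.
  by exists s, z; split=> //; apply/triangleP; rewrite (sedge_sym t).
have [xs' xt'] := apex x xB xs xt.
by exists s, t; split=> //; apply/triangleP; rewrite !(sedge_sym x).
Qed.

Lemma nontrivial_triangleI B x y z : block B -> triangle x y z ->
  x \in B -> y \in B -> z \in B -> nontrivial_block B.
Proof.
move=> bB T xB yB zB; rewrite /nontrivial_block bB /=; apply/negP => /existsP[S].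
case/and5P=> _ /eqP S2 /eqP/eqP; rewrite cards_eq0 setD_eq0 => BS _ _.
have : size [:: x; y; z] <= #|S|; last by rewrite S2.
rewrite cardE; apply: uniq_leq_size; first exact: triangle_uniq T.
by move=> u; rewrite mem_enum !inE => /or3P[]/eqP->; apply: (subsetP BS).
Qed.

Lemma exit_nbr B B' x : connected_graph G -> #|G| <> 1 -> block B -> block B' ->
  B != B' -> x \in B -> x \in B' -> exists2 w, w \notin B & x -- w.
Proof.
move=> conG G1 bB bB' BB' xB xB'; have [w wB' xw] := block_two conG G1 bB' xB'.
exists w => //; apply: contra BB' => wB; apply/eqP.
exact: block_share bB bB' (adj_neq xw) xB xB' wB wB'.
Qed.

End CrownBlocks.

Section CrownStructure.
Variable G : sgraph.
Hypotheses (conG : connected_graph G) (G1 : #|G| <> 1).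
Hypotheses (chG : chordal G) (frG : free_of F3ch G).
Implicit Types (a b c d l m s t u v w x y z : G) (A B C K S : {set G}) (p : seq G).

Lemma blocks_are_crowns B : block B -> crown B.
Proof.
move=> bB; have [/set0Pn[x xB] _ _] := cutlessP _ (block_cutless bB).
have [y yB xy] := block_two conG G1 bB xB.
exact (block_crown chG frG bB xB yB xy).
Qed.

Lemma joining_path_degree2 B B' x p : nontrivial_block B -> nontrivial_block B' ->
  joining_path B B' x p -> 0 < set_dist B B' ->
  exists2 i, 0 < i < size p & degree (nth x (x :: p) i) = 2.
Proof.
move=> nB nB' J BB'; have [xB lB' _ _] := J.
have [bB _] := andP nB; have [bB' _] := andP nB'.
have [a [b [aB bB_ T]]] := nontrivial_triangle nB (blocks_are_crowns bB) xB.
have [c [d [cB dB T']]] := nontrivial_triangle nB' (blocks_are_crowns bB') lB'.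
exact (linked_degree2 conG chG frG (joining_linked conG J BB' aB bB_ T cB dB T')).
Qed.

(** For each block a base containing all its shared vertices is chosen if there
    is one, and any base otherwise; in the latter case the block has to be an
    exempt triangle. Indeed, some apex [z] is shared, hence has a neighbour
    outside the block, so there is no second apex by the fact on diamonds. In a
    triangle every edge is a base, so without a suitable one the two corners
    other than any given corner [v] are both shared, and a nontrivial block at
    [v] would contradict the fact on two triangles meeting in [v]. *)
Lemma share_only_in_bases_free : share_only_in_bases G.
Proof.
pose is_base B S := crown_with_base #|B :\: S| B S.
pose shared B : {set G} := [set x in B | [exists B', [&& block B', B' != B & x \in B']]].
have has_base B : block B -> exists S, is_base B S.
  move=> /blocks_are_crowns[n /existsP[S SB]]; exists S.
  by rewrite /is_base -(crown_sizeE SB).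
have sharedI B B' x : block B' -> B' != B -> x \in B -> x \in B' -> x \in shared B.
  by move=> bB' BB' xB xB'; rewrite inE xB /=; apply/existsP; exists B'; rewrite bB' BB'.
have sharedP B x : block B -> x \in shared B -> x \in B /\ exists2 w, w \notin B & x -- w.
  move=> bB; rewrite inE => /andP[xB /existsP[B' /and3P[bB' BB' xB']]]; split=> //.
  by apply: exit_nbr bB bB' _ xB xB'; rewrite 1?eq_sym.
have exempt B : block B -> (forall S, is_base B S -> ~~ (shared B \subset S)) ->
    exempt_triangle B.
  move=> bB no_base; have [S SB] := has_base B bB.
  have [s [t [SE [sB tB] st apex indep]]] := crown_with_baseP SB.
  have /subsetPn[z zsh zS] := no_base S SB.
  have [zB [w wB zw]] := sharedP B z bB zsh.
  move: zS; rewrite SE !inE negb_or => /andP[zs zt].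
  have [sz tz] := apex z zB zs zt.
  have only x : x \in B -> x \in [:: s; t; z].
    move=> xB; rewrite !inE; apply: contraT; rewrite !negb_or => /and3P[xs xt xz].
    have [sx tx] := apex x xB xs xt.
    case/negP: wB; have := @diamond_adj _ chG frG s t x z w st.
    by rewrite !(sedge_sym x, sedge_sym z s, sedge_sym z t); case=> // ->.
  have T : triangle s t z by apply/triangleP.
  split.
    apply/existsP; exists S; have := SB; rewrite /is_base (_ : B :\: S = [set z]) ?cards1 //.
    apply/setP=> x; rewrite SE in_set1 in_setD in_set2.
    apply/andP/eqP => [[xS xB]|->]; last by rewrite zB negb_or zs zt.
    by move: (only x xB) xS; rewrite !inE negb_or => /or3P[]/eqP-> //; rewrite eqxx ?andbF.
  move=> B' bB' B'B /set0Pn[v]; rewrite inE => /andP[vB vB']; rewrite /trivial_block bB' /=.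
  apply: contraT => nt; exfalso.
  have nB' : nontrivial_block B' by rewrite /nontrivial_block bB'.
  have [c [d [cB' dB' Tc]]] := nontrivial_triangle nB' (blocks_are_crowns bB') vB'.
  have [a [b [Ta Ea]]] := triangle_pick T (only v vB).
  have onlyv x : x \in B -> x \in [:: v; a; b] by rewrite Ea; apply: only.
  have inB x : x \in [:: v; a; b] -> x \in B by rewrite Ea !inE => /or3P[]/eqP->.
  have [va vb ab] := triangleP _ _ _ Ta; have [vc vd cd] := triangleP _ _ _ Tc.
  have [aB bB_] : a \in B /\ b \in B by split; apply: inB; rewrite !inE eqxx ?orbT.
  (* a base made of [v] and one more corner misses the third corner, which
     must therefore be shared *)
  have corner x y : triangle v x y -> [:: v; x; y] =i [:: v; a; b] -> y \in shared B.
    move=> Tx Ex; have [vx vy xy] := triangleP _ _ _ Tx.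
    have onlyx u : u \in B -> u != v -> u != x -> u = y.
      by move=> /onlyv; rewrite -Ex !inE => /or3P[]/eqP-> //; rewrite eqxx.
    have xB : x \in B by apply: inB; rewrite -Ex !inE eqxx orbT.
    have base : is_base B [set v; x].
      apply: crown_of_base => //.
        by move=> u uB uv ux; rewrite (onlyx u uB uv ux) (sedge_sym y) vy sedge_sym xy.
      move=> u1 u2 uB1 uB2 n1 n2 n3 n4; rewrite (onlyx u1 uB1 n1 n2) (onlyx u2 uB2 n3 n4).
      by rewrite sedge_irrefl.
    have /subsetPn[u ush uS] := no_base _ base.
    have [uB _] := sharedP B u bB ush.
    by move: uS; rewrite in_set2 negb_or => /andP[uv ux]; rewrite -(onlyx u uB uv ux).
  have bsh : b \in shared B by apply: (corner a b).
  have ash : a \in shared B.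
    apply: (corner b a); first by apply/triangleP; rewrite (sedge_sym b).
    by move=> u; rewrite !inE [(u == b) || _]orbC.
  have deg x y : x \in shared B -> y \in B -> v -- x -> x -- y -> v != y -> degree x <> 2.
    move=> xsh yB vx xy vy dx; have [xB [k kB xk]] := sharedP B x bB xsh.
    case: (degree2_adj dx (_ : x -- v) xy vy xk); first by rewrite sedge_sym.
      by move=> E; rewrite E vB in kB.
    by move=> E; rewrite E yB in kB.
  have out x y : x \in B -> y \in B' -> v -- x -> x != y.
    move=> xB yB' vx; apply: contraNneq B'B => E; apply/eqP/esym.
    by apply: (@block_share _ _ _ v x) => //; rewrite ?adj_neq // E.
  case: (two_triangles_degree2 chG frG va vb ab vc vd cd); try exact: out.
    by apply: deg ash bB_ va ab (adj_neq vb).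
  by apply: deg bsh aB vb _ (adj_neq va); rewrite sedge_sym.
pose base B := if [pick S | is_base B S && (shared B \subset S)] is Some S0 then S0
  else odflt B [pick S | is_base B S].
exists base; split.
  move=> B bB; exists #|B :\: base B|; rewrite -/(is_base B (base B)) /base.
  case: pickP => [S /andP[]//|_]; case: pickP => //= no.
  by have [S] := has_base B bB; rewrite no.
move=> B B' x bB bB' BB' xB xB' nex; rewrite /base.
case: pickP => [S /andP[_ /subsetP sub]|no].
  by apply: sub; apply: sharedI bB' _ xB xB'; rewrite eq_sym.
by case: nex; apply: exempt => // S SB; have := no S; rewrite SB => /negbT.
Qed.

Lemma crown_structure_free : crown_structure G.
Proof.
split; first exact: blocks_are_crowns.
- move=> B B' nB nB'; have [bB _] := andP nB; have [bB' _] := andP nB'.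
  have [/set0Pn[x0 x0B] _ _] := cutlessP _ (block_cutless bB).
  have [/set0Pn[y0 y0B] _ _] := cutlessP _ (block_cutless bB').
  have [x [p J]] := joining_path_exists conG x0B y0B; have [xB lB' _ ps] := J.
  have [d0|d_pos] := posnP (set_dist B B').
    left; apply/set0Pn; exists x; rewrite inE xB /=.
    by move: ps lB'; rewrite d0; case: (p).
  right; have [i ip _] := joining_path_degree2 nB nB' J d_pos.
  by rewrite -ps; lia.
- exact: share_only_in_bases_free.
- move=> B B' nB nB' d_pos x p J.
  have [i /andP[_ ip] di] := joining_path_degree2 nB nB' J d_pos.
  by exists (nth x (x :: p) i); rewrite // mem_nth //= ltnS ltnW.
Qed.

End CrownStructure.

(** * The crown structure implies freeness *)
Section BaseGeometry.
Variable G : sgraph.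
Implicit Types (a b c d l m s t u v w x y z : G) (A B C K S : {set G}) (p : seq G).

(** A triangle without a base vertex [k] would have two corners that are apexes,
    but apexes are pairwise non-adjacent. *)
Lemma base_in_triangle n B S x y z : crown_with_base n B S -> triangle x y z ->
  x \in B -> y \in B -> z \in B -> {subset S <= [:: x; y; z]}.
Proof.
move=> SB T xB yB zB; have [s [t [SE _ _ apex indep]]] := crown_with_baseP SB.
have no k : k = s \/ k = t -> k \in [:: x; y; z].
  move=> kst; apply: contraT => kN; exfalso.
  (* The other vertex of the base. *)
  pose k' := if k == s then t else s.
  have kk' u : u != k -> u != k' -> u != s /\ u != t.
    rewrite /k'; case: kst => ->; rewrite ?eqxx; first by split.
    by have [<-|_] := eqVneq t s => ut us; split.
  have apexT u : u \in [:: x; y; z] -> u != k' -> u != s /\ u != t.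
    by move=> uT; apply: kk'; apply: contraNneq kN => <-.
  have pair u v : u \in [:: x; y; z] -> v \in [:: x; y; z] -> u -- v -> u != k' -> v != k' -> False.
    move=> uT vT uv /(apexT u uT)[us ut] /(apexT v vT)[vs vt].
    have inB q : q \in [:: x; y; z] -> q \in B by rewrite !inE => /or3P[]/eqP->.
    by have := indep u v (inB u uT) (inB v vT) us ut vs vt; rewrite uv.
  have [xy xz yz] := triangleP _ _ _ T.
  have [xT yT zT] : [/\ x \in [:: x; y; z], y \in [:: x; y; z] & z \in [:: x; y; z]].
    by rewrite !inE !eqxx !orbT.
  have [xk|xk] := eqVneq x k'.
    by apply: (pair y z); rewrite // -xk eq_sym adj_neq.
  have [yk|yk] := eqVneq y k'.
    by apply: (pair x z) => //; rewrite -yk eq_sym adj_neq.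
  exact: (pair x y).
by move=> k; rewrite SE in_set2 => /orP[]/eqP->; [apply: (no s); left|apply: (no t); right].
Qed.

Lemma crown_two_nbrs n B S x y z w : crown_with_base n B S -> triangle x y z ->
  x \in B -> y \in B -> z \in B -> w \in B -> w \notin [:: x; y; z] ->
  exists s t, [/\ s \in [:: x; y; z], t \in [:: x; y; z], s != t, w -- s & w -- t].
Proof.
move=> SB T xB yB zB wB wN; have [s [t [SE _ st apex _]]] := crown_with_baseP SB.
have sub := base_in_triangle SB T xB yB zB.
have sT : s \in [:: x; y; z] by apply: sub; rewrite SE !inE eqxx.
have tT : t \in [:: x; y; z] by apply: sub; rewrite SE !inE eqxx orbT.
have ws : w != s by apply: contraNneq wN => ->.
have wt : w != t by apply: contraNneq wN => ->.
have [sw tw] := apex w wB ws wt.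
by exists s, t; split; rewrite ?adj_neq // sedge_sym.
Qed.

(** A further vertex of a crown is adjacent to both base vertices, hence to two
    corners of each triangle. *)
Lemma pendant_notin n B S x y z w : crown_with_base n B S -> triangle x y z ->
  x \in B -> y \in B -> z \in B -> w -- x -> w != x ->
  ~~ (w -- y) -> ~~ (w -- z) -> w != y -> w != z -> w \notin B.
Proof.
move=> SB T xB yB zB wx nwx wy wz nwy nwz; apply/negP => wB.
have [|s [t [sT tT st ws wt]]] := crown_two_nbrs SB T xB yB zB wB.
  by rewrite !inE !negb_or nwx nwy nwz.
move: sT tT st ws wt; rewrite !inE => /or3P[]/eqP-> /or3P[]/eqP->;
  by rewrite ?eqxx ?(negbTE wy) ?(negbTE wz).
Qed.

Lemma base_cardN n B S s : crown_with_base n B S -> ~ {subset S <= [:: s]}.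
Proof.
case/crown_with_baseP => u [v [-> _ uv _ _]] sub; have := adj_neq uv.
have : u \in [:: s] by apply: sub; rewrite !inE eqxx.
have : v \in [:: s] by apply: sub; rewrite !inE eqxx orbT.
by rewrite !inE => /eqP-> /eqP->; rewrite eqxx.
Qed.

Lemma triangle_block x y z : triangle x y z ->
  exists B, [/\ block B, x \in B, y \in B & z \in B].
Proof.
case/triangleP=> xy xz yz.
have [|||||B bB /subsetP sub] := cutless_block (@cutless_ear _ [set x; y] x y [:: z] _ _ _ _ _).
- exact: cutless_edge.
- by rewrite !inE eqxx.
- by rewrite !inE eqxx orbT.
- by rewrite /= xz sedge_sym yz.
- by rewrite /= !inE negb_or (adj_neq xy) (adj_neq xz) [z == y]eq_sym (adj_neq yz).
by exists B; split=> //; apply: sub; rewrite !inE eqxx ?orbT.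
Qed.

Lemma edge_block x y : x -- y -> exists B, [/\ block B, x \in B & y \in B].
Proof.
move=> xy; have [B bB /subsetP sub] := cutless_block (cutless_edge xy).
by exists B; split=> //; apply: sub; rewrite !inE eqxx ?orbT.
Qed.

Lemma triangle_block_edge B x y z : block B -> x \in B -> y \in B ->
  triangle x y z -> z \in B.
Proof.
move=> bB xB yB T; have [B' [bB' xB' yB' zB']] := triangle_block T.
have [xy _ _] := triangleP _ _ _ T.
by rewrite (block_share bB bB' (adj_neq xy) xB xB' yB yB').
Qed.

End BaseGeometry.

Section FreeOfCrownStructure.
Variable G : sgraph.
Hypotheses (conG : connected_graph G) (chG : chordal G) (crG : crown_structure G).
Implicit Types (a b c d l m s t u v w x y z : G) (A B C K S : {set G}) (p : seq G).

(** A shortest path [P] between the blocks has a vertex [P i] of degree 2. It is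
    an interior vertex, as the ends have two neighbours in their block and one
    on the path. Its neighbours on [P] are not adjacent, but they are joined by
    a detour through the first block, the path [u] and the second block, none
    of which contains [P i]. *)
Lemma no_linked_blocks B B' (u : nat -> G) n :
  nontrivial_block B -> nontrivial_block B' -> B :&: B' = set0 ->
  u 0 \in B -> u n \in B' -> (forall i, i < n -> u i -- u i.+1) ->
  (forall i, i <= n -> degree (u i) != 2) -> False.
Proof.
move=> nB nB' disj u0 un upath udeg.
have [crown_bl far _ deg2] := crG.
have [bB _] := andP nB; have [bB' _] := andP nB'.
have d2 : 2 <= set_dist B B' by case: (far B B' nB nB'); rewrite ?disj ?eqxx.
have d0 := ltnW d2.
have [x [p J]] := joining_path_exists conG u0 un; have [xB lB' pP ps] := J.
have [z zp dz] := deg2 B B' nB nB' d0 x p J.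
have [a1 [b1 [aB bB_ Ta]]] := nontrivial_triangle nB (crown_bl B bB) xB.
have [c1 [d1 [cB dB Tc]]] := nontrivial_triangle nB' (crown_bl B' bB') lB'.
have L := joining_linked conG J d0 aB bB_ Ta cB dB Tc.
have [P [M [PL P0 PM MB [i iM zE]]]] : exists P M, [/\ linked M P a1 b1 c1 d1,
    P 0 = x, P M = last x p, M = set_dist B B' & exists2 i, i <= M & z = P i].
  exists (nth x (x :: p)), (size p); split=> //.
    by rewrite -[size p]/(size (x :: p)).-1 nth_last.
  by case/(nthP x): zp => i ip <-; exists i.
subst z; clear L zp J ps pP.
have distP i j : i <= j <= M -> dist (P i) (P j) = j - i := linked_dist conG PL.
have outB : forall j, 0 < j <= M -> P j \notin B.
  move=> j /andP[j0 jM]; apply/negP => jB.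
  have := set_dist_le_dist conG jB lB'; rewrite -MB -PM distP; last by rewrite jM leqnn.
  by clear -j0 jM; lia.
have outB' : forall j, j < M -> P j \notin B'.
  move=> j jM; apply/negP => jB.
  have := set_dist_le_dist conG xB jB; rewrite -MB -P0 distP; last exact: ltnW.
  by clear -jM; lia.
have [xa xb ab] := triangleP _ _ _ Ta; have [lc ld cd] := triangleP _ _ _ Tc.
have end_deg v v1 v2 w (D : {set G}) : v -- v1 -> v -- v2 -> v1 != v2 ->
    v1 \in D -> v2 \in D -> w \notin D -> v -- w -> degree v <> 2.
  move=> vv1 vv2 v12 D1 D2 wD vw dv.
  by case: (degree2_adj dv vv1 vv2 v12 vw) => E; rewrite E ?D1 ?D2 in wD.
have step i j : i < j <= M -> P i != P j /\ (P i -- P j) = (j == i.+1) := linked_adj conG PL.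
have M2 : 2 <= M by rewrite MB.
have P_step j : j < M -> P j -- P j.+1.
  by move=> jM; have [_ ->] := step j j.+1 ltac:(clear -jM; lia).
case: (posnP i) => [i0|i0].
  have P01 : P 0 -- P 1 by apply: P_step; apply: ltnW.
  rewrite i0 P0 in dz; rewrite P0 in P01.
  exact: end_deg xa xb (adj_neq ab) aB bB_ (outB 1 (ltnW M2)) P01 dz.
case: (ltngtP i M) iM => // [im _|iE _]; last first.
  have PMM : P M -- P M.-1.
    by rewrite sedge_sym -[X in _ -- P X](ltn_predK M2); apply: P_step; rewrite (ltn_predK M2).
  rewrite iE PM in dz; rewrite PM in PMM; rewrite iE in i0.
  have oM : P M.-1 \notin B' by apply: outB'; rewrite prednK.
  exact: end_deg lc ld (adj_neq cd) cB dB oM PMM dz.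
have i11 : i.-1 < i.+1 <= M by clear -i0 im; lia.
have [ne E] := step i.-1 i.+1 i11.
have ip : P i -- P i.-1.
  by rewrite sedge_sym -[X in _ -- P X](prednK i0); apply: P_step; rewrite prednK // ltnW.
have is_ : P i -- P i.+1 by apply: P_step.
suff : P i.-1 -- P i.+1 by rewrite E; clear -i0; lia.
have neP k : k <= M -> k != i -> P k \in [set~ P i].
  move=> kM ki; rewrite in_setC1; case: (ltngtP k i) ki => // ki _.
    by have [] := step k i (introT andP (conj ki (ltnW im))).
  by have [] := step i k (introT andP (conj ki kM)); rewrite eq_sym.
have iB : P i \notin B by apply: outB; rewrite i0 ltnW.
have iB' := outB' i im.
have Bsub : B \subset [set~ P i].
  by apply/subsetP => q qB; rewrite in_setC1; apply: contraNneq iB => <-.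
have B'sub : B' \subset [set~ P i].
  by apply/subsetP => q qB; rewrite in_setC1; apply: contraNneq iB' => <-.
apply: (chordal_detour chG ip is_ ne (A := [set~ P i])).
- by rewrite !inE eqxx.
- apply: (@con_trans _ _ x).
    rewrite con_sym -P0; apply: nat_path_con => // k ki.
      by apply: P_step; clear -ki im; lia.
    by apply: neP; clear -ki im i0; lia.
  apply: con_trans (con_sub Bsub (block_con bB xB u0)) _.
  apply: (@con_trans _ _ (u n)).
    apply: nat_path_con => // k /andP[_ kn].
    by rewrite in_setC1; apply: contraTneq (udeg k kn) => ->; rewrite negbK; apply/eqP.
  apply: con_trans (con_sub B'sub (block_con bB' un lB')) _.
  rewrite -PM con_sym; apply: nat_path_con => // k ki.
    by apply: P_step; clear -ki; lia.
  by apply: neP; clear -ki; lia.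
- by move=> q _; apply: degree2_adj dz ip is_ ne.
Qed.

(** In [K4] and the gem, the triangles would have a whole base in common but share
    at most one vertex. In the kite the base is the common edge of the two
    triangles, yet the vertex carrying the pendant vertex is shared with another
    block. In [X127] the three corners of one triangle are all shared and would
    all belong to its base. In [D k] the end triangles lie in disjoint blocks,
    and the spine between them has no vertex of degree 2. *)
Lemma free_of_crown_structure : free_of F3ch G.
Proof.
have [crown_bl far [base [baseP shareP]] _] := crG.
move=> H FH; case: FH => [|||| k k4] [f finj fE].
- pose o i (lt : i < 4) := f (Ordinal lt : K4).
  have T i j k (li : i < 4) (lj : j < 4) (lk : k < 4) :
      [&& i != j, i != k & j != k] -> triangle (o i li) (o j lj) (o k lk).
    by case/and3P=> ij ik jk; rewrite /triangle !fE /= /symirr_rel /= -!val_eqE /= ij ik jk.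
  have [B [bB aB bB_ cB]] := triangle_block (T 0 1 2 isT isT isT isT).
  have dB := triangle_block_edge bB aB bB_ (T 0 1 3 isT isT isT isT).
  have [n SB] := baseP B bB; apply: (@base_cardN _ _ _ _ (o 0 isT) SB) => s sS.
  have := base_in_triangle SB (T 0 1 2 isT isT isT isT) aB bB_ cB sS.
  have := base_in_triangle SB (T 0 1 3 isT isT isT isT) aB bB_ dB sS.
  have := base_in_triangle SB (T 0 2 3 isT isT isT isT) aB cB dB sS.
  rewrite !inE; case: eqP => //= _ /orP[]/eqP->; rewrite !(inj_eq finj) //=.
- pose o i (lt : i < 5) := f (Ordinal lt : kite).
  have T1 : triangle (o 1 isT) (o 2 isT) (o 0 isT) by rewrite /triangle !fE.
  have T2 : triangle (o 1 isT) (o 2 isT) (o 3 isT) by rewrite /triangle !fE.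
  have T3 : triangle (o 3 isT) (o 1 isT) (o 2 isT) by rewrite /triangle !fE.
  have [B [bB sB tB lB]] := triangle_block T1.
  have mB := triangle_block_edge bB sB tB T2.
  have [n SB] := baseP B bB.
  have wB : o 4 isT \notin B.
    by apply: (pendant_notin SB T3 mB sB tB); rewrite ?fE ?(inj_eq finj).
  have wm : o 4 isT -- o 3 isT by rewrite fE.
  have [B' [bB' wB' mB']] := edge_block wm.
  have mS : o 3 isT \in base B.
    apply: (shareP B B') => //; first by apply: contraNneq wB => ->.
    case=> /existsP[S SB1] _.
    have sub1 := base_in_triangle SB1 T1 sB tB lB; have sub2 := base_in_triangle SB1 T2 sB tB mB.
    have : #|[set o 0 isT; o 3 isT]| <= #|B :\: S|.
      apply: subset_leq_card; apply/subsetP => q; rewrite in_set2 in_setD.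
      case/orP=> /eqP->; [rewrite lB andbT; apply/negP => /sub2|rewrite mB andbT; apply/negP => /sub1];
        by rewrite !inE !(inj_eq finj).
    by rewrite -(crown_sizeE SB1) cards2 (inj_eq finj).
  have := base_in_triangle SB T1 sB tB lB mS.
  by rewrite !inE !(inj_eq finj).
- pose o i (lt : i < 5) := f (Ordinal lt : gem).
  have T1 : triangle (o 4 isT) (o 1 isT) (o 0 isT) by rewrite /triangle !fE.
  have T2 : triangle (o 4 isT) (o 1 isT) (o 2 isT) by rewrite /triangle !fE.
  have T3 : triangle (o 4 isT) (o 2 isT) (o 3 isT) by rewrite /triangle !fE.
  have [B [bB hB b1 b0]] := triangle_block T1.
  have b2 := triangle_block_edge bB hB b1 T2.
  have b3 := triangle_block_edge bB hB b2 T3.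
  have [n SB] := baseP B bB; apply: (@base_cardN _ _ _ _ (o 4 isT) SB) => s sS.
  have := base_in_triangle SB T1 hB b1 b0 sS.
  have := base_in_triangle SB T3 hB b2 b3 sS.
  by rewrite !inE; case: eqP => //= _ /orP[]/eqP->; rewrite !(inj_eq finj).
- pose o i (lt : i < 7) := f (Ordinal lt : X127).
  have T1 : triangle (o 0 isT) (o 1 isT) (o 2 isT) by rewrite /triangle !fE.
  have T2 : triangle (o 0 isT) (o 3 isT) (o 4 isT) by rewrite /triangle !fE.
  have T1a : triangle (o 1 isT) (o 0 isT) (o 2 isT) by rewrite /triangle !fE.
  have T1b : triangle (o 2 isT) (o 0 isT) (o 1 isT) by rewrite /triangle !fE.
  have [B [bB vB aB bB_]] := triangle_block T1.
  have [B' [bB' vB' cB' dB']] := triangle_block T2.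
  have [n SB] := baseP B bB.
  have BB' : B != B'.
    apply/eqP => E; rewrite -E in vB' cB' dB'.
    apply: (@base_cardN _ _ _ _ (o 0 isT) SB) => s sS.
    have := base_in_triangle SB T1 vB aB bB_ sS.
    have := base_in_triangle SB T2 vB' cB' dB' sS.
    by rewrite !inE; case: eqP => //= _ /orP[]/eqP->; rewrite !(inj_eq finj).
  have nB' := nontrivial_triangleI bB' T2 vB' cB' dB'.
  have nex : ~ exempt_triangle B.
    case=> _ ex; have B'B : B' != B by rewrite eq_sym.
    have meet : B :&: B' != set0 by apply/set0Pn; exists (o 0 isT); rewrite inE vB.
    have /andP[_ t0] := ex B' bB' B'B meet.
    by case/andP: nB' => _; rewrite t0.
  have inS x y z w : triangle x y z -> x \in B -> y \in B -> z \in B ->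
      w -- x -> ~~ (w -- y) -> ~~ (w -- z) -> w != y -> w != z -> x \in base B.
    move=> T xB yB zB wx wy wz nwy nwz.
    have wB := pendant_notin SB T xB yB zB wx (adj_neq wx) wy wz nwy nwz.
    have [B2 [bB2 wB2 xB2]] := edge_block wx.
    by apply: (shareP B B2) => //; apply: contraNneq wB => ->.
  have aS := inS _ _ _ (o 5 isT) T1a aB vB bB_; rewrite !fE !(inj_eq finj) in aS.
  have bS := inS _ _ _ (o 6 isT) T1b bB_ vB aB; rewrite !fE !(inj_eq finj) in bS.
  have vS := shareP B B' _ bB bB' BB' vB vB' nex.
  have /and5P[_ /eqP S2 _ _ _] := SB.
  have : size [:: o 0 isT; o 1 isT; o 2 isT] <= #|base B|; last by rewrite S2.
  rewrite cardE; apply: uniq_leq_size; first exact: triangle_uniq T1.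
  by move=> q; rewrite mem_enum !inE => /or3P[]/eqP-> //; [apply: aS|apply: bS].
- case: k k4 f finj fE => [|[|[|[|m]]]] // _ f finj fE.
  have [u [v [uu uv vv]]] := D_copy (ex_intro2 _ _ f finj fE).
  have path i : i <= m.+2 -> u i -- u i.+1.
    by move=> im; have [_ ->] := uu i i.+1 ltac:(clear -im; lia).
  have uvE i j : i <= m.+3 -> minn i.-1 m.+1 = j -> u i -- v j.
    by move=> im <-; have [_ ->] := uv i (minn i.-1 m.+1) im ltac:(clear; lia).
  have T1 : triangle (u 1) (u 0) (v 0).
    by apply/triangleP; split; [rewrite sedge_sym path|apply: uvE; clear; lia|apply: uvE; clear; lia].
  have T2 : triangle (u m.+2) (u m.+3) (v m.+1).
    by apply/triangleP; split; [rewrite path|apply: uvE; clear; lia|apply: uvE; clear; lia].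
  have [B [bB u1B u0B v0B]] := triangle_block T1.
  have [B' [bB' u2B u3B v3B]] := triangle_block T2.
  have [n SB] := baseP B bB; have [n' SB'] := baseP B' bB'.
  have u2 : u 2 \notin B.
    have [n20 a20] := uu 0 2 isT; have [nv av] := uv 2 0 isT isT.
    apply: (pendant_notin SB T1 u1B u0B v0B).
    + by rewrite sedge_sym path.
    + by apply: adj_neq; rewrite sedge_sym path.
    + by rewrite sedge_sym a20.
    + by rewrite av; clear; lia.
    + by rewrite eq_sym.
    + exact: nv.
  have um : u m.+1 \notin B'.
    have [n1 a1] := uu m.+1 m.+3 ltac:(clear; lia).
    have [nv av] := uv m.+1 m.+1 ltac:(clear; lia) ltac:(clear; lia).
    apply: (pendant_notin SB' T2 u2B u3B v3B).
    + exact: path.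
    + exact/adj_neq/path.
    + by rewrite a1; clear; lia.
    + by rewrite av; clear; lia.
    + exact: n1.
    + exact: nv.
  have neq i j : i < j <= m.+3 -> u i != u j by move=> /uu[].
  (* A common vertex would let the spine return to one of the blocks after
     leaving it. *)
  have disj : B :&: B' = set0.
    apply/setP=> x; rewrite in_set0 inE; apply/negP => /andP[xB xB'].
    have [E|xu] := eqVneq x (u 1).
      apply: (block_gate bB' u2B um _ (_ : u 1 \in B')).
      + by rewrite sedge_sym path.
      + by rewrite -E.
      + by apply: neq; clear; lia.
      + rewrite con_sym; apply: nat_path_con => // [i im|i im]; first by apply: path; clear -im; lia.
        by rewrite in_setC1; apply: neq; clear -im; lia.
    apply: (block_gate bB u1B u2 _ xB xu); first exact: path.
    apply: (@con_trans _ _ (u m.+2)).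
      apply: nat_path_con => // [i im|i im]; first by apply: path; clear -im; lia.
      by rewrite in_setC1 eq_sym; apply: neq; clear -im; lia.
    apply: con_sub (block_conD bB' u2B xB' _ xu); last by rewrite eq_sym; apply: neq; clear; lia.
    by apply/subsetP => q; rewrite in_setD1 in_setC1 => /andP[].
  have deg i : 0 < i <= m.+2 -> degree (u i) != 2.
    move=> im; apply/eqP => di.
    have e1 : u i -- u i.-1.
      rewrite sedge_sym; have := path i.-1.
      by rewrite prednK; [apply; clear -im; lia|clear -im; lia].
    have e2 : u i -- u i.+1 by apply: path; clear -im; lia.
    have [ne1 _] := uv i.-1 i.-1 ltac:(clear -im; lia) ltac:(clear -im; lia).
    have [ne2 _] := uv i.+1 i.-1 ltac:(clear -im; lia) ltac:(clear -im; lia).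
    have e3 : u i -- v i.-1 by apply: uvE; clear -im; lia.
    case: (degree2_adj di e1 e2 (neq i.-1 i.+1 ltac:(clear -im; lia)) e3) => E.
      by rewrite E eqxx in ne1.
    by rewrite E eqxx in ne2.
  apply: (@no_linked_blocks B B' (fun i => u i.+1) m.+1) => //.
  + exact: nontrivial_triangleI bB T1 u1B u0B v0B.
  + exact: nontrivial_triangleI bB' T2 u2B u3B v3B.
  + by move=> i im; apply: path; clear -im; lia.
  + by move=> i im; apply: deg; clear -im; lia.
Qed.

End FreeOfCrownStructure.

(** * The equivalence *)

(** This disposes of the one-vertex graph, for which the structural condition is
    void. *)
Lemma F3ch_two_vertices (H : sgraph) : F3ch H -> exists x y : H, x != y.
Proof.
case=> [||||k k4].
- by exists (@Ordinal 4 0 isT), (@Ordinal 4 1 isT).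
- by exists (@Ordinal 5 0 isT), (@Ordinal 5 1 isT).
- by exists (@Ordinal 5 0 isT), (@Ordinal 5 1 isT).
- by exists (@Ordinal 7 0 isT), (@Ordinal 7 1 isT).
by case: k k4 => [|[|k]] // _; exists (inl (@Ordinal k.+2 0 isT)), (inl (@Ordinal k.+2 1 isT)).
Qed.

Unset Implicit Arguments.

Theorem theorem2p3 (G : sgraph) (conG : connected_graph G) (chG : chordal G) :
  (free_of F3ch G <-> (#|G| <> 1 -> crown_structure G)) /\
  ((#|G| <> 1 -> crown_structure G) <-> chi_star G <= 3).
Proof.
have free_structure : free_of F3ch G -> #|G| <> 1 -> crown_structure G.
  by move=> frG G1; apply: crown_structure_free.
have structure_free : (#|G| <> 1 -> crown_structure G) -> free_of F3ch G.
  move=> cr H FH copy; apply: (free_of_crown_structure conG chG (cr _) FH copy) => G1.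
  have [f finj _] := copy; have [x [y]] := F3ch_two_vertices FH.
  have /fintype1P[z zE] : #|G| == 1 by rewrite G1.
  by rewrite -(inj_eq finj) (zE (f x)) (zE (f y)) eqxx.
have free_star : free_of F3ch G <-> chi_star G <= 3.
  split=> [frG|/chi_star_le3/free_of_star_colorable//].
  exact/chi_star_le3/star_colorable_of_free.
split; split.
- exact: free_structure.
- exact: structure_free.
- by move=> /structure_free/free_star.
- by move=> /free_star/free_structure.
Qed.
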